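(* Let $n=k(k+1)/2\leq 300$ for some positive integer $k$. Suppose $\tau$ is a polynomial in $x,y$ of degree $2n$ with real coefficients satisfying \[ \tau(x,y)=\tau(x,-y)=\tau(-x,y) \] and \[ \left(\mathfrak{D}_{x}^{2}+\mathfrak{D}_{y}^{2}-\mathfrak{D}_{x}^{4}\right)\tau\cdot\tau=0. \] Then $\tau$ is unique, up to a multiplicative constant; that is, any two polynomials of degree $2n$ with these properties are constant multiples of each other.
   Context: $\mathfrak{D}$ denotes the Hirota bilinear derivative: for functions $f,g$ of $(x,y)$, \[ \mathfrak{D}_x^{m}\mathfrak{D}_y^{l} f\cdot g=(\partial_x-\partial_{x'})^m(\partial_y-\partial_{y'})^l\big[f(x,y)g(x',y')\big]\Big|_{x'=x,\,y'=y}. \] *)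

(* Defs.v *)
From HB Require Import structures.
From mathcomp Require Import all_boot all_order all_algebra.
From mathcomp Require Import mpoly.
From mathcomp Require Import reals.

Set Implicit Arguments.
Unset Strict Implicit.
Unset Printing Implicit Defensive.

Import GRing.Theory.
Local Open Scope ring_scope.

Definition bisubst (R : comNzRingType) (N : nat) (p : {mpoly R[2]})
    (a b : {mpoly R[N]}) : {mpoly R[N]} :=
  p \mPo [tuple a; b].

(* In {mpoly R[2]} the variables 0, 1 are x, y; in {mpoly R[4]} the variables
   0, 1, 2, 3 are x, y, x', y'. The last substitution sets x' = x, y' = y. *)
Definition hirota (R : comNzRingType) (m l : nat) (f g : {mpoly R[2]}) :
    {mpoly R[2]} :=
  let fg : {mpoly R[4]} := bisubst f 'X_0 'X_1 * bisubst g 'X_2 'X_3 in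
  let Dx (F : {mpoly R[4]}) := F^`M(0) - F^`M(2) in
  let Dy (F : {mpoly R[4]}) := F^`M(1) - F^`M(3) in
  iter m Dx (iter l Dy fg) \mPo [tuple 'X_0; 'X_1; 'X_0; 'X_1].

(* [msize p] is the total degree of p plus one, and is 0 for p = 0. *)
Definition has_total_degree (R : nzRingType) (N d : nat) (p : {mpoly R[N]}) :
    Prop :=
  msize p = d.+1.

Definition is_even_lump_tau (R : comNzRingType) (n : nat) (tau : {mpoly R[2]}) :
    Prop :=
  [/\ has_total_degree (2 * n) tau,
      tau = bisubst tau 'X_0 (- 'X_1),
      tau = bisubst tau (- 'X_0) 'X_1
    & hirota 2 0 tau tau + hirota 0 2 tau tau - hirota 4 0 tau tau = 0].

(* Main.v *)
Require Import Defs.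
From HB Require Import structures.
From mathcomp Require Import all_boot all_order all_algebra.
From mathcomp Require Import mpoly.
From mathcomp Require Import reals.
From mathcomp Require Import complex generic_quotient fraction.
From mathcomp Require Import ring zify.

Set Implicit Arguments.
Unset Strict Implicit.
Unset Printing Implicit Defensive.

Import GRing.Theory.
Local Open Scope ring_scope.

(** In the complex coordinates z = x + i y and w = x - i y the operator
    D_x^2 + D_y^2 - D_x^4 becomes 4 D_z D_w - (D_z + D_w)^4
    ([hirota_to_zw]); evenness in y is symmetry under exchange of z and w,
    and the two parities together leave only monomials of even total degree.
    The proof reads the equation on faces of the Newton polygon, in the plane
    of exponents (a, b) of z^a w^b.

    Give z the weight p and w the weight q, with q <= p.  The top-weight part
    of the equation involves the top-weight parts of its arguments alone: for
    p < 3 q only D_z D_w contributes ([face_laplace]), while at (p, q) = (3, 1)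
    the terms 4 D_z D_w and D_w^4 balance and give the bilinear KdV equation
    ([face_kdv]).

    Shape of a solution T.  If D_z D_w kills a weighted homogeneous polynomial
    bilinearly, that polynomial is a single monomial ([face_monomial]).  With
    weights (1, 1) and the symmetry, the top-degree part of T is a multiple of
    (z w)^n ([zw_tau_top]).  An edge of the Newton polygon that leaves (n, n)
    with a weight vector of ratio p/q < 3 would be a face with two monomials,
    so the support of T lies in 3 a + b <= 4 n ([zw_tau_weight31]).

    Comparison of two solutions.  Normalise T and T' to have the same
    coefficient at (z w)^n, and put D = T' - T and S = T' + T.  Since the
    equation is quadratic, D and S are bilinearly related
    ([hirota_zw_polarization]), and S has the same leading faces as T up to a
    factor 2.  If D is nonzero, the equations on the faces with p < 3 q force
    its top-degree part to contain z^n w^k with k < n and n - k even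
    ([deformation_top]), and bound its (3, 1)-weight by 3 n + k
    ([deformation_weight31]).  The (3, 1)-faces theta of T, of degree n in w,
    and phi of D, of degree k, then satisfy the bilinear KdV equation and its
    linearisation.

    Why this is absurd ([face_rigidity]).  Homogeneity turns the equations
    into ordinary differential equations in w: u = (theta'/theta)' solves the
    self-similar KdV equation, and g = (phi/theta)' solves the linearised
    potential KdV equation with weight s = n - k.  The KdV recursion operator,
    which self-similarity makes free of antiderivatives, sends solutions of
    weight s to solutions of weight s + 2 ([lin_kdv_recursion]).  On the
    leading coefficient of g at infinity it acts by a multiple of
    (s + 1) (s + 3) - 8 n ([recursion_at_infty]), which is odd, hence nonzero,
    because s is even.  So there are nonzero rational solutions that decay at
    infinity as fast as one likes.  But at a zero of theta of multiplicity mu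
    the order r of a pole of a solution satisfies (r + 1) (r + 2) = 12 mu, so
    theta^3 g is always a polynomial ([lin_kdv_denominator]) and the decay of g
    is at most that of theta^-3: a contradiction.

    Over the complex numbers this gives proportionality; the factor is a
    quotient of two real coefficients, hence real. *)

(** * Self-similar KdV in a differential ring *)
Section DifferentialRing.
Variables (K : idomainType) (d : K -> K).
Hypotheses (dD : forall x y, d (x + y) = d x + d y)
  (dM : forall x y, d (x * y) = d x * y + x * d y).

Lemma derivation1 : d 1 = 0.
Proof.
apply: (@addrI _ (d 1)); rewrite addr0.
by rewrite -{3}[1](mulr1 1) dM mulr1 mul1r.
Qed.

Lemma derivation0 : d 0 = 0.
Proof. by apply: (@addrI _ (d 0)); rewrite -dD !addr0. Qed.

Lemma derivationN x : d (- x) = - d x.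
Proof. by apply: (@addrI _ (d x)); rewrite -dD !subrr derivation0. Qed.

Lemma derivation_nat k : d k%:R = 0.
Proof. by elim: k => [|k IH]; rewrite ?derivation0 // mulrS dD derivation1 IH addr0. Qed.

Definition dE := (dD, dM, derivationN, derivation1, derivation_nat).

Variables (w t : K).
Hypotheses (dw : d w = 1) (dt : d t = 0).

(** The KdV equation for a potential of scaling weight -2: the time derivative
    has been replaced by the scaling operator 2 u + w u'. *)
Definition kdv (u : K) : K :=
  d (d (d u)) + 12%:R * u * d u + t * (2%:R * u + w * d u).

(** The linearisation of the potential KdV equation: a potential v with
    v' = u is varied by g, and g has scaling weight - (s + 1). *)
Definition lin_kdv (u : K) (s : nat) (g : K) : K :=
  d (d (d g)) + 12%:R * u * d g + t * (w * d g + s.+1%:R * g).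

(** The KdV recursion operator g'' + 8 u g - 4 I, where I is an antiderivative
    of u' g, multiplied by t (s + 3).  For solutions of the two self-similar
    equations t (s + 3) I may be taken to be 2 t u g - u' g'' + u'' g'. *)
Definition recursion (u : K) (s : nat) (g : K) : K :=
  t * (s.+3%:R * d (d g) + 8%:R * s.+2%:R * u * g) + 4%:R * (d u * d (d g) - d (d u) * d g).

(** The recursion operator commutes with the linearised flow; here this is a
    differential-polynomial identity modulo the two equations, which eliminate
    the third derivatives of u and g. *)
Lemma lin_kdv_recursion u s g :
  kdv u = 0 -> lin_kdv u s g = 0 -> lin_kdv u s.+2 (recursion u s g) = 0.
Proof.
rewrite /kdv /lin_kdv /recursion -!addrA => /eqP + /eqP.
rewrite !addr_eq0 => /eqP U3 /eqP E3.
have ES k : k.+1%:R = 1 + k%:R :> K by rewrite mulrS.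
rewrite !(ES s.+2) !(ES s.+1) (ES s) in E3 *.
have sD : d (s%:R) = 0 by exact: derivation_nat.
move: (s%:R) sD E3 => a sD E3.
(* e and v are the third derivatives of g and u; G1 and G2 are the first two
   derivatives of the image with these third derivatives eliminated. *)
pose e := - (12%:R * u * d g + t * (w * d g + (1 + a) * g)).
pose v := - (12%:R * u * d u + t * (2%:R * u + w * d u)).
set G := (X in d (d (d X))).
have G1 : d G = (t * (a + 3%:R) + 4%:R * d u) * e
    + t * 8%:R * (a + 2%:R) * (d u * g + u * d g) - 4%:R * v * d g.
  rewrite /G /e /v !(dE, dw, dt, sD, mul0r, mulr0, add0r, addr0) E3 U3; ring.
have G2 : d (d G) = 4%:R * d (d u) * e
    - (t * (a + 3%:R) + 4%:R * d u) * (12%:R * (d u * d g + u * d (d g))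
          + t * (w * d (d g) + (2%:R + a) * d g))
    + t * 8%:R * (a + 2%:R) * (d (d u) * g + 2%:R * d u * d g + u * d (d g))
    - 4%:R * v * d (d g) + 4%:R * (12%:R * (d u * d u + u * d (d u))
          + t * (3%:R * d u + w * d (d u))) * d g.
  rewrite G1 /e /v !(dE, dw, dt, sD, mul0r, mulr0, add0r, addr0); ring.
rewrite -/G G2 G1 /G /e /v !(dE, dw, dt, sD, mul0r, mulr0, add0r, addr0) E3 U3.
ring.
Qed.

(** By Euler's identity this is 3 times the z-derivative, at z = 1, of a
    polynomial that is homogeneous of weight N for the weights (3, 1). *)
Definition wtz (N : nat) x : K := N%:R * x - w * d x.

(** With t = 4/3 this is 4 D_z D_w - D_w^4 on weighted homogeneous polynomials
    of weights M and N, restricted to z = 1. *)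
Definition hirota_face (M N : nat) (x y : K) : K :=
  t * (d (wtz M x) * y + x * d (wtz N y) - wtz M x * d y - d x * wtz N y)
  - (d (d (d (d x))) * y - 4%:R * (d (d (d x)) * d y) + 6%:R * (d (d x) * d (d y))
     - 4%:R * (d x * d (d (d y))) + x * d (d (d (d y)))).

Lemma hirota_faceDr M N x y z :
  hirota_face M N x (y + z) = hirota_face M N x y + hirota_face M N x z.
Proof. by rewrite /hirota_face /wtz !(dE); ring. Qed.

Variables (th l : K).
Hypotheses (th0 : th != 0) (two0 : 2%:R != 0 :> K) (lE : d th = l * th).

(** Divided by 2 th^2, the bilinear equation is an equation for the
    logarithmic derivative l = th'/th: the self-similar potential KdV equation. *)
Lemma hirota_face_log N : hirota_face N N th th = 0 ->
  t * (l + w * d l) + d (d (d l)) + 6%:R * d l * d l = 0.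
Proof.
rewrite /hirota_face /wtz => H.
have := derivation_nat N; move: (N%:R) H => m H mD.
apply: (mulfI two0); apply: (mulfI th0); apply: (mulfI th0).
rewrite !mulr0 -[RHS]oppr0 -[in RHS]H.
rewrite !(lE, dE, dw, dt, mD, mul0r, mulr0, add0r, addr0).
ring.
Qed.

Lemma hirota_face_kdv N : hirota_face N N th th = 0 -> kdv (d l) = 0.
Proof.
move/hirota_face_log/(congr1 d); rewrite derivation0 => H.
rewrite /kdv -[RHS]H !(dE, dw, dt, mul0r, mulr0, add0r, addr0); ring.
Qed.

(** A variation phi = f th of th changes log th by f at first order, hence l by
    f'.  The weight drop s from th to phi becomes the scaling weight of f. *)
Lemma hirota_face_lin_kdv M s f :
  hirota_face (M + s) (M + s) th th = 0 -> hirota_face M (M + s) (f * th) th = 0 ->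
  lin_kdv (d l) s (d f) = 0.
Proof.
move=> /hirota_face_log HL.
rewrite /hirota_face /wtz /lin_kdv natrD (mulrS _ s) => H.
have := derivation_nat M; move: (M%:R) H => m H mD.
have := derivation_nat s; move: (s%:R) H => a H aD.
apply: (mulfI th0); apply: (mulfI th0).
rewrite !mulr0 -[RHS]oppr0 -[in RHS]H -[LHS]addr0.
(* The terms in f without derivative are f times the equation for th. *)
rewrite -(mulr0 (2%:R * th * th * f)) -HL.
rewrite !(lE, dE, dw, dt, mD, aD, mul0r, mulr0, add0r, addr0).
ring.
Qed.
End DifferentialRing.

(** * Rational functions and their behaviour at infinity *)
Lemma coef_topM (R : nzRingType) (p q : {poly R}) (a b : nat) :
  (size p <= a.+1)%N -> (size q <= b.+1)%N ->
  (size (p * q)%R <= (a + b).+1)%N /\ (p * q)`_(a + b) = p`_a * q`_b.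
Proof.
move=> sp sq; split.
  by apply: leq_trans (size_polyMleq _ _) _; move: sp sq; lia.
have la : (a < (a + b).+1)%N by lia.
rewrite coefM (bigD1 (Ordinal la)) //= addKn big1 ?addr0 // => -[i /= li].
rewrite -val_eqE /= => ia.
have [lia|lai] := ltnP i a.
  by rewrite [q`_ _]nth_default ?mulr0 // (leq_trans sq) //; lia.
by rewrite [p`_ _]nth_default ?mul0r // (leq_trans sp) //; lia.
Qed.

Section RationalFunctions.
Variable F : numClosedFieldType.
Local Notation K := {fraction {poly F}}.
Local Notation "p %:F" := (tofrac p).
Implicit Types (x y : K) (p q : {poly F}).

Lemma frac_repr x : x = (\n_(repr x))%:F / (\d_(repr x))%:F.
Proof.
have dx0 := denom_ratioP (repr x).
apply: (canRL (mulfK _)); first by rewrite tofrac_eq0.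
rewrite -[LHS]/(x * _) -{1}[x]reprK; unlock FracField.tofrac.
rewrite -[LHS]FracField.pi_mul; apply/eqmodP; rewrite /= FracField.equivfE.
rewrite /FracField.mulf !numden_Ratio ?mulf_neq0 ?oner_eq0 //.
by rewrite !mulr1 mulrC.
Qed.

Lemma fracP x : exists n d, d != 0 /\ x = n%:F / d%:F.
Proof.
exists \n_(repr x), \d_(repr x); split; first exact: denom_ratioP.
exact: frac_repr.
Qed.

Fact fderiv_key : unit. Proof. exact: tt. Qed.

(** The quotient rule applied to a chosen representative; [quotient_rule_wd]
    is the independence of the choice. *)
Definition fderiv := locked_with fderiv_key (fun x : K =>
  let n := \n_(repr x) in let d := \d_(repr x) in
  (n^`() * d - n * d^`())%:F / (d ^+ 2)%:F).

Lemma quotient_rule_wd n d p q : d != 0 -> q != 0 -> n%:F / d%:F = p%:F / q%:F ->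
  (n^`() * d - n * d^`())%:F / (d ^+ 2)%:F
  = (p^`() * q - p * q^`())%:F / (q ^+ 2)%:F.
Proof.
move=> d0 q0 /eqP; rewrite eqr_div ?tofrac_eq0 // -!tofracM tofrac_eq => /eqP E.
have := congr1 (@deriv F) E; rewrite !derivM => E'.
apply/eqP; rewrite eqr_div ?tofrac_eq0 ?expf_neq0 // -!tofracM tofrac_eq.
apply/eqP; apply/eqP; rewrite -subr_eq0; apply/eqP.
have -> : (n^`() * d - n * d^`()) * q ^+ 2 - (p^`() * q - p * q^`()) * d ^+ 2
   = (n^`() * q + n * q^`() - (p^`() * d + p * d^`())) * (d * q)
     - (n * q - p * d) * (d^`() * q + q^`() * d) by ring.
by rewrite E' E !subrr !mul0r subrr.
Qed.

Lemma fderiv_quotient p q : q != 0 ->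
  fderiv (p%:F / q%:F) = (p^`() * q - p * q^`())%:F / (q ^+ 2)%:F.
Proof.
by move=> q0; rewrite /fderiv unlock; apply: quotient_rule_wd; rewrite ?denom_ratioP // -frac_repr.
Qed.

Lemma fderiv_poly p : fderiv p%:F = (p^`())%:F.
Proof.
rewrite -[p%:F]divr1 -tofrac1 fderiv_quotient ?oner_neq0 //.
by rewrite mulr1 -polyC1 derivC mulr0 subr0 polyC1 expr1n tofrac1 divr1.
Qed.

Lemma fderivD x y : fderiv (x + y) = fderiv x + fderiv y.
Proof.
have [n [d [d0 ->]]] := fracP x; have [p [q [q0 ->]]] := fracP y.
rewrite addf_div ?tofrac_eq0 // -!tofracM -tofracD !fderiv_quotient ?mulf_neq0 //.
rewrite addf_div ?tofrac_eq0 ?expf_neq0 // -!tofracM -tofracD.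
apply/eqP; rewrite eqr_div ?tofrac_eq0 ?mulf_neq0 ?expf_neq0 // -!tofracM.
by rewrite tofrac_eq derivD !derivM; apply/eqP; ring.
Qed.

Lemma fderivM x y : fderiv (x * y) = fderiv x * y + x * fderiv y.
Proof.
have [n [d [d0 ->]]] := fracP x; have [p [q [q0 ->]]] := fracP y.
rewrite mulf_div -!tofracM !fderiv_quotient ?mulf_neq0 //.
rewrite !mulf_div -!tofracM.
rewrite addf_div ?tofrac_eq0 ?mulf_neq0 ?expf_neq0 // -!tofracM -tofracD.
apply/eqP; rewrite eqr_div ?tofrac_eq0 ?mulf_neq0 ?expf_neq0 // -!tofracM.
by rewrite tofrac_eq !derivM; apply/eqP; ring.
Qed.

Lemma fderiv_const (c : F) : fderiv (c%:P)%:F = 0.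
Proof. by rewrite fderiv_poly derivC tofrac0. Qed.

Lemma fderiv_X : fderiv ('X : {poly F})%:F = 1.
Proof. by rewrite fderiv_poly derivX tofrac1. Qed.

(** x = c w^-r + lower-order terms at infinity, with c = 0 allowed.  Numerator
    and denominator are measured against the degrees e and e + r, and the
    denominator is normalised to be monic. *)
Definition at_infty x (r : nat) (c : F) := exists e p q,
  [/\ (size p <= e.+1)%N /\ p`_e = c, (size q <= (e + r).+1)%N, q`_(e + r) = 1
    & x = p%:F / q%:F].

Lemma neq0_coef1 q k : q`_k = 1 -> q%:F != 0.
Proof.
by rewrite tofrac_eq0 => qk; apply: contra_eqN qk => /eqP->; rewrite coef0 eq_sym oner_eq0.
Qed.

Lemma at_inftyD x y r c c' :
  at_infty x r c -> at_infty y r c' -> at_infty (x + y) r (c + c').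
Proof.
move=> [e [p [q [[sp pe] sq q1 ->]]]] [e' [p' [q' [[sp' pe'] sq' q1' ->]]]].
have [s1 c1] := coef_topM sp sq'; have [s2 c2] := coef_topM sp' sq.
have [s3 c3] := coef_topM sq sq'.
exists (e + e' + r)%N, (p * q' + p' * q), (q * q').
have eqE : (e + e' + r + r = e + r + (e' + r))%N by lia.
have d1 := neq0_coef1 q1; have d1' := neq0_coef1 q1'.
split; last first.
- by rewrite (addf_div _ _ d1 d1') -!tofracM -tofracD.
- by rewrite eqE c3 q1 q1' mulr1.
- by rewrite eqE.
rewrite coefD.
have -> : (e + e' + r = e + (e' + r))%N by lia.
have e2 : (e' + (e + r) = e + (e' + r))%N by lia.
rewrite c1 -[X in (p' * q)`_ X]e2 c2 q1 q1' pe pe' !mulr1; split=> //.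
by apply: leq_trans (size_polyD _ _) _; rewrite geq_max s1 -e2.
Qed.

Lemma at_inftyM x y r r' c c' :
  at_infty x r c -> at_infty y r' c' -> at_infty (x * y) (r + r') (c * c').
Proof.
move=> [e [p [q [[sp pe] sq q1 ->]]]] [e' [p' [q' [[sp' pe'] sq' q1' ->]]]].
have [s1 c1] := coef_topM sp sp'; have [s3 c3] := coef_topM sq sq'.
exists (e + e')%N, (p * p'), (q * q').
have eqE : (e + e' + (r + r') = e + r + (e' + r'))%N by lia.
split; last by rewrite mulf_div -!tofracM.
- by rewrite c1 pe pe'.
- by rewrite eqE.
- by rewrite eqE c3 q1 q1' mulr1.
Qed.

Lemma at_infty_weaken x r r' c : (r < r')%N -> at_infty x r' c -> at_infty x r 0.
Proof.
move=> rr [e [p [q [[sp pe] sq q1 ->]]]].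
have eqE : (e + (r' - r) + r = e + r')%N by lia.
exists (e + (r' - r))%N, p, q; rewrite eqE; split=> //.
by split; [apply: leq_trans sp _ | rewrite nth_default // (leq_trans sp) //]; lia.
Qed.

Lemma at_inftyN x r c : at_infty x r c -> at_infty (- x) r (- c).
Proof.
move=> [e [p [q [[sp pe] sq q1 ->]]]]; exists e, (- p), q.
by rewrite size_polyN coefN pe tofracN mulNr; split.
Qed.

Lemma at_infty_const (c : F) : at_infty (c%:P)%:F 0 c.
Proof.
exists 0, c%:P, 1; rewrite tofrac1 divr1 coefC eqxx coef1 eqxx size_poly1.
by split=> //; rewrite size_polyC leq_b1.
Qed.

Lemma at_infty_nat k : at_infty k%:R 0 k%:R.
Proof. by have := at_infty_const k%:R; rewrite polyCMn tofracMn polyC1 tofrac1. Qed.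

(** The operator w d/dw preserves degrees; this lets the derivative be handled
    uniformly, including in degree 0. *)
Lemma coef_topXderiv p e : (size p <= e.+1)%N ->
  (size ('X * p^`())%R <= e.+1)%N /\ ('X * p^`())`_e = e%:R * p`_e.
Proof.
move=> sp; split; last first.
  by case: e sp => [|e] _; rewrite mulrC coefMX ?mul0r //= coef_deriv mulr_natl.
have [->|p'0] := eqVneq p^`() 0; first by rewrite mulr0 size_poly0.
rewrite mulrC size_mulX //; apply: leq_trans sp.
by apply: lt_size_deriv; apply: contraNneq p'0 => ->; rewrite deriv0.
Qed.

Lemma at_infty_deriv x r c : at_infty x r c -> at_infty (fderiv x) r.+1 (- r%:R * c).
Proof.
move=> [e [p [q [[sp pe] sq q1 ->]]]].
have [s1 c1] := coef_topXderiv sp; have [s2 c2] := coef_topXderiv sq.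
have [s3 c3] := coef_topM s1 sq; have [s4 c4] := coef_topM sp s2.
have [s5 c5] := coef_topM sq sq.
have q0 := neq0_coef1 q1; rewrite tofrac_eq0 in q0.
exists (e + (e + r))%N, ('X * p^`() * q - p * ('X * q^`())), ('X * (q * q)).
split.
- split; last by rewrite coefB c3 c4 c1 c2 q1 pe natrD; ring.
  by apply: leq_trans (size_polyD _ _) _; rewrite size_polyN geq_max s3.
- have -> : (e + (e + r) + r.+1 = (e + r + (e + r)).+1)%N by lia.
  by rewrite mulrC size_mulX ?mulf_neq0.
- have -> : (e + (e + r) + r.+1 = (e + r + (e + r)).+1)%N by lia.
  by rewrite mulrC coefMX /= c5 q1 mulr1.
rewrite fderiv_quotient //; apply/eqP.
rewrite eqr_div ?tofrac_eq0 ?expf_neq0 ?mulf_neq0 ?polyX_eq0 // -!tofracM tofrac_eq.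
by apply/eqP; ring.
Qed.

End RationalFunctions.

(** * Poles of rational functions *)
Section Poles.
Variable F : numClosedFieldType.
Local Notation K := {fraction {poly F}}.
Local Notation "p %:F" := (tofrac p).
Implicit Types (x y : K) (p q : {poly F}).
Variable a : F.

(** x = c (w - a)^-r + higher-order terms at a, with c = 0 allowed. *)
Definition at_pole x (r : nat) (c : F) := exists p q,
  [/\ q.[a] != 0, p.[a] = c * q.[a] & x = p%:F / (q * ('X - a%:P) ^+ r)%:F].

Lemma frac_eq p q p' q' : q != 0 -> q' != 0 -> p * q' = p' * q ->
  p%:F / q%:F = p'%:F / q'%:F.
Proof.
move=> q0 q0' E; apply/eqP.
by rewrite eqr_div ?tofrac_eq0 // -!tofracM tofrac_eq E.
Qed.

Lemma pole_denom_neq0 q r : q.[a] != 0 -> q * ('X - a%:P) ^+ r != 0.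
Proof.
move=> qa; rewrite mulf_neq0 ?expf_neq0 ?polyXsubC_eq0 //.
by apply: contraNneq qa => ->; rewrite horner0.
Qed.

Lemma at_poleD x y r c c' :
  at_pole x r c -> at_pole y r c' -> at_pole (x + y) r (c + c').
Proof.
move=> [p [q [qa pa ->]]] [p' [q' [qa' pa' ->]]].
exists (p * q' + p' * q), (q * q'); split.
- by rewrite hornerM mulf_neq0.
- by rewrite ?hornerD !hornerM pa pa'; ring.
have d := pole_denom_neq0 r qa; have d' := pole_denom_neq0 r qa'.
have qq : (q * q').[a] != 0 by rewrite hornerM mulf_neq0.
have d2 := pole_denom_neq0 r qq.
have e := d; have e' := d'; rewrite -tofrac_eq0 in e; rewrite -tofrac_eq0 in e'.
rewrite (addf_div _ _ e e') -!tofracM -tofracD; apply: frac_eq => //.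
  by rewrite mulf_neq0.
ring.
Qed.

Lemma at_poleM x y r r' c c' :
  at_pole x r c -> at_pole y r' c' -> at_pole (x * y) (r + r') (c * c').
Proof.
move=> [p [q [qa pa ->]]] [p' [q' [qa' pa' ->]]].
exists (p * p'), (q * q'); split.
- by rewrite hornerM mulf_neq0.
- by rewrite ?hornerD !hornerM pa pa'; ring.
by rewrite mulf_div -!tofracM; congr (_ / _%:F); rewrite exprD; ring.
Qed.

Lemma at_pole_weaken x r r' c : (r < r')%N -> at_pole x r c -> at_pole x r' 0.
Proof.
move=> rr [p [q [qa pa ->]]].
exists (p * ('X - a%:P) ^+ (r' - r)), q; split=> //.
  by rewrite hornerM horner_exp hornerXsubC subrr expr0n subn_eq0 leqNgt rr mulr0 mul0r.
apply: frac_eq; rewrite ?pole_denom_neq0 //.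
by rewrite -[in LHS](subnK (ltnW rr)) exprD; ring.
Qed.

Lemma at_pole_poly p : at_pole p%:F 0 p.[a].
Proof.
by exists p, 1; rewrite hornerC oner_eq0 mulr1 expr0 mulr1 tofrac1 divr1.
Qed.

Lemma at_pole_nat k : at_pole k%:R 0 k%:R.
Proof.
have := at_pole_poly k%:R%:P.
by rewrite hornerC polyCMn tofracMn polyC1 tofrac1.
Qed.

Lemma at_pole_eq0 r c : at_pole 0 r c -> c = 0.
Proof.
move=> [p [q [qa pa /esym/eqP]]].
rewrite mulf_eq0 invr_eq0 !tofrac_eq0 (negbTE (pole_denom_neq0 r qa)) orbF => /eqP p0.
by move: pa; rewrite p0 horner0 => /esym/eqP; rewrite mulf_eq0 (negbTE qa) orbF => /eqP.
Qed.

Lemma derivXsubCX r : (('X - a%:P) ^+ r)^`() * ('X - a%:P) = r%:R *: ('X - a%:P) ^+ r.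
Proof.
case: r => [|r]; first by rewrite expr0 -polyC1 derivC mul0r scale0r.
by rewrite deriv_exp derivXsubC mul1r /= mulrnAl -exprSr scaler_nat.
Qed.

Lemma at_pole_deriv x r c : at_pole x r c -> at_pole (fderiv x) r.+1 (- r%:R * c).
Proof.
move=> [p [q [qa pa ->]]].
have d := pole_denom_neq0 r qa.
exists ((p^`() * q - p * q^`()) * ('X - a%:P) - r%:R *: (p * q)), (q * q); split.
- by rewrite hornerM mulf_neq0.
- rewrite !(hornerD, hornerN, hornerZ, hornerM, hornerX, hornerC) pa. ring.
have qq : (q * q).[a] != 0 by rewrite hornerM mulf_neq0.
have d2 := pole_denom_neq0 r.+1 qq.
rewrite fderiv_quotient //; apply: frac_eq => //; first by rewrite expf_neq0.
have E := derivXsubCX r; move: E; rewrite exprS derivM -!mul_polyC.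
set z := _ ^+ r; move: z ('X - a%:P) (r%:R%:P) => z y k E.
transitivity (q * q * z * ((p^`() * q - p * q^`()) * z * y - p * q * (z^`() * y))).
  by ring.
by rewrite E; ring.
Qed.

End Poles.

(** * Rational solutions of the linearised equation *)
Section RationalSolutions.
Variable F : numClosedFieldType.
Local Notation K := {fraction {poly F}}.
Local Notation "p %:F" := (tofrac p).
Implicit Types (x y g : K) (p q : {poly F}).
Variables (t : F) (theta : {poly F}) (n : nat).
Hypotheses (t0 : t != 0) (size_theta : size theta = n.+1).

Let w : K := 'X%:F.
Let u : K := fderiv (theta^`()%:F / theta%:F).
Local Notation lkdv := (lin_kdv (@fderiv F) w t%:P%:F u).

Let theta0 : theta != 0. Proof. by rewrite -size_poly_eq0 size_theta. Qed.

(** theta'/theta is asymptotic to n/w. *)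
Lemma potential_at_infty : at_infty u 2 (- n%:R).
Proof.
have -> : - n%:R = - 1%:R * n%:R :> F by rewrite mulN1r.
apply: at_infty_deriv; pose c := (lead_coef theta)^-1.
have c0 : c != 0 by rewrite invr_eq0 lead_coef_eq0.
have thn : theta`_n = lead_coef theta by rewrite lead_coefE size_theta.
have [s1 c1] := @coef_topXderiv _ theta n (eq_leq size_theta).
exists n, (c *: ('X * theta^`())), (c *: ('X * theta)); split.
- by rewrite size_scale // coefZ c1 thn mulrCA mulVf ?lead_coef_eq0 // mulr1.
- by rewrite size_scale // (mulrC 'X) size_mulX // size_theta addn1.
- by rewrite coefZ addn1 (mulrC 'X) coefMX /= thn mulVf ?lead_coef_eq0.
apply: frac_eq => //; first by rewrite scaler_eq0 negb_or c0 mulf_neq0 ?polyX_eq0.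
by rewrite -!mul_polyC; ring.
Qed.

(** theta'/theta is asymptotic to mu/(w - a). *)
Lemma potential_at_pole a mu theta1 :
  theta = theta1 * ('X - a%:P) ^+ mu -> theta1.[a] != 0 ->
  at_pole a u 2 (- mu%:R).
Proof.
move=> E th1.
have -> : - mu%:R = - 1%:R * mu%:R :> F by rewrite mulN1r.
apply: at_pole_deriv.
exists (theta1^`() * ('X - a%:P) + mu%:R *: theta1), theta1; split=> //.
  by rewrite !(hornerXsubC, hornerD, hornerZ, hornerM) subrr mulr0 add0r.
apply: frac_eq => //; first exact: pole_denom_neq0.
have := derivXsubCX a mu; rewrite E derivM expr1 -!mul_polyC.
set z := _ ^+ mu; move: z ('X - a%:P) (mu%:R%:P) => z y k E'.
transitivity (theta1 * (theta1^`() * y * z + theta1 * (z^`() * y))); first by ring.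
by rewrite E'; ring.
Qed.

(** Only g''' and 12 u g' reach the order r + 3 at a; the vanishing of their
    leading coefficient is (r + 1) (r + 2) = 12 mu when r is positive, and this
    implies r <= 3 mu. *)
Lemma lin_kdv_pole_order a mu s g r c :
  at_pole a u 2 (- mu%:R) -> lkdv s g = 0 -> at_pole a g r c -> c != 0 ->
  (r <= 3 * mu)%N.
Proof.
move=> hu hg g0 c0; case: r g0 => // r g0.
have g1 := at_pole_deriv g0; have g2 := at_pole_deriv g1; have g3 := at_pole_deriv g2.
have h12 := at_poleM (at_poleM (at_pole_nat a 12) hu) g1.
have hw := at_poleM (at_pole_poly a 'X) g1.
have hs := at_pole_weaken (ltnSn _) (at_poleM (at_pole_nat a s.+1) g0).
have ht := at_poleM (at_pole_poly a t%:P) (at_poleD hw hs).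
have ht' : at_pole a (t%:P%:F * ('X%:F * fderiv g + s.+1%:R * g)) r.+4 0.
  by apply: at_pole_weaken ht; rewrite !add0n.
have := at_poleD (at_poleD g3 h12) ht'.
rewrite -[X in at_pole a X]/(lkdv s g) hg => /at_pole_eq0 /eqP.
have -> : - r.+3%:R * (- r.+2%:R * (- r.+1%:R * c))
    + 12%:R * - mu%:R * (- r.+1%:R * c) + 0
  = r.+1%:R * c * ((12 * mu)%:R - (r.+3 * r.+2)%:R) by rewrite !natrM; ring.
rewrite !mulf_eq0 (negbTE c0) Num.Theory.pnatr_eq0 /= subr_eq0 Num.Theory.eqr_nat => /eqP.
nia.
Qed.

(** By [lin_kdv_pole_order] the factor theta^3 clears every pole of g; in
    particular mu = 0 excludes poles away from the zeros of theta. *)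
Lemma lin_kdv_denominator s g : lkdv s g = 0 ->
  exists p, g * theta%:F ^+ 3 = p%:F.
Proof.
move=> hg; (* Induction on the size of a denominator q: a root of q is either cancelled
   against the numerator or is a pole of too large an order. *)
have [p [q [q0]]] := fracP (g * theta%:F ^+ 3).
move: {2}(size q) (leqnn (size q)) => k.
elim: k p q q0 => [|k IH] p q q0 sq E; first by rewrite leqn0 size_poly_eq0 (negbTE q0) in sq.
have [/size_poly1P[c c0 qc]|] := boolP (size q == 1%N).
  exists (c^-1 *: p); rewrite E qc -[RHS]divr1 -tofrac1; apply: frac_eq.
  - by rewrite polyC_eq0.
  - exact: oner_neq0.
  by rewrite mulr1 -mul_polyC mulrAC -polyCM mulVf // mul1r.
move/closed_rootP => [a ra]; have /factor_theorem [q1 q1E] := ra.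
have q10 : q1 != 0 by apply: contraNneq q0 => q10; rewrite q1E q10 mul0r.
have [/factor_theorem [p1 p1E]|pa] := boolP (root p a).
  apply: (IH p1 q1) => //.
    by move: sq; rewrite q1E size_mul ?polyXsubC_eq0 // size_XsubC addn2.
  by rewrite E p1E q1E; apply: frac_eq => //; rewrite ?mulf_neq0 ?polyXsubC_eq0 //; ring.
have [e [q2 hq2 q2E]] := multiplicity_XsubC q a.
have [mu [th hth thE]] := multiplicity_XsubC theta a.
rewrite q0 /= in hq2; rewrite theta0 /= in hth.
have e0 : (0 < e)%N.
  by case: e q2E => // q2E; move: hq2; rewrite q2E expr0 mulr1 in ra; rewrite ra.
have hg' : at_pole a g (e + 3 * mu) (p.[a] / (q2 * th ^+ 3).[a]).
  have d0 : (q2 * th ^+ 3).[a] != 0 by rewrite hornerM horner_exp mulf_neq0 ?expf_neq0.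
  exists p, (q2 * th ^+ 3); split=> //; first by rewrite divfK.
  have t3 : theta%:F ^+ 3 != 0 by rewrite expf_neq0 // tofrac_eq0.
  apply: (mulIf t3); rewrite E -tofracXn mulrAC -tofracM; apply: frac_eq => //.
    exact: pole_denom_neq0.
  rewrite exprD mulnC exprM {1}thE {1}q2E; ring.
have := lin_kdv_pole_order (potential_at_pole thE hth) hg hg' _.
have -> : p.[a] / (q2 * th ^+ 3).[a] != 0.
  by rewrite mulf_neq0 // invr_eq0 hornerM horner_exp mulf_neq0 ?expf_neq0.
by move=> /(_ isT); lia.
Qed.

(** The polynomial theta^3 g has degree 3 n - (s + 1). *)
Lemma lin_kdv_weight_bound s g c : lkdv s g = 0 ->
  at_infty g s.+1 c -> c != 0 -> (s.+1 <= 3 * n)%N.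
Proof.
move=> /lin_kdv_denominator [h hE] [e [p [q [[sp pe] sq q1 gE]]]] c0.
have p0 : p != 0 by apply: contraNneq c0 => p0; rewrite -pe p0 coef0.
have qF := neq0_coef1 q1; have q0 := qF; rewrite tofrac_eq0 in q0.
have E : p * theta ^+ 3 = h * q.
  apply/eqP; rewrite -tofrac_eq tofracM tofracXn [(h * q)%:F]tofracM -hE gE; apply/eqP.
  by rewrite mulrAC divfK.
have h0 : h != 0.
  apply: contraNneq p0 => h0; move/eqP: E; rewrite h0 mul0r mulf_eq0.
  by rewrite expf_eq0 (negbTE theta0) /= orbF.
have sq1 : (e + s.+1 < size q)%N.
  by apply: contra_eqT q1; rewrite -leqNgt => /leq_sizeP/(_ _ (leqnn _))->; rewrite eq_sym oner_eq0.
have := size_exp theta 3; rewrite size_theta /=.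
have t30 : theta ^+ 3 != 0 by rewrite expf_neq0.
have := size_mul p0 t30; rewrite E size_mul //.
move: p0 q0 h0 t30; rewrite -!size_poly_gt0.
move: (size (theta ^+ 3)) (size p) (size q) (size h) sp sq1; lia.
Qed.

(** Since u is asymptotic to - n w^-2, the terms g'' and u g contribute at
    order s + 3 and the products u' g'' and u'' g' only at order s + 6. *)
Lemma recursion_at_infty s g c : at_infty g s.+1 c ->
  at_infty (recursion (@fderiv F) t%:P%:F u s g) s.+3
    (t * s.+2%:R * ((s.+1 * s.+3)%:R - (8 * n)%:R) * c).
Proof.
move=> g0; have g1 := at_infty_deriv g0; have g2 := at_infty_deriv g1.
have u0 := potential_at_infty; have u1 := at_infty_deriv u0; have u2 := at_infty_deriv u1.
have ha := at_inftyM (at_infty_nat F s.+3) g2.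
have hb := at_inftyM (at_inftyM (at_inftyM (at_infty_nat F 8) (at_infty_nat F s.+2)) u0) g0.
have hc := at_inftyD (at_inftyM u1 g2) (at_inftyN (at_inftyM u2 g1)).
have lt3 : (s.+3 < 0 + (3 + s.+3))%N by lia.
have h4 := at_infty_weaken lt3 (at_inftyM (at_infty_nat F 4) hc).
have := at_inftyD (at_inftyM (at_infty_const t) (at_inftyD ha hb)) h4.
rewrite /recursion add0n addr0; congr at_infty.
by rewrite !natrM !mulrS; ring.
Qed.

(** For even s the factor (s + 1) (s + 3) - 8 n is odd, so iterating the
    recursion operator never loses the leading coefficient, and eventually
    violates [lin_kdv_weight_bound]. *)
Lemma lin_kdv_even_eq0 s g c : kdv (@fderiv F) w t%:P%:F u = 0 -> ~~ odd s ->
  lkdv s g = 0 -> at_infty g s.+1 c -> c = 0.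
Proof.
move=> hu s2 hg gc; apply/eqP/negPn/negP => c0.
have H j : exists g' c', [/\ lkdv (s + j.*2)%N g' = 0,
    at_infty g' (s + j.*2).+1 c' & c' != 0].
  elim: j => [|j [g' [c' [hg' gc' c0']]]]; first by exists g, c; rewrite addn0.
  exists (recursion (@fderiv F) t%:P%:F u (s + j.*2)%N g'); eexists.
  rewrite doubleS !addnS; split.
  - apply: lin_kdv_recursion hu hg'; first exact: fderivD.
    + exact: fderivM.
    + exact: fderiv_X.
    + exact: fderiv_const.
  - exact: recursion_at_infty gc'.
  rewrite !mulf_neq0 ?Num.Theory.pnatr_eq0 // subr_eq0 Num.Theory.eqr_nat.
  by apply/eqP => /(congr1 odd); rewrite !oddM /= !oddD odd_double addbF (negbTE s2).
(* After 3 n steps the weight s + 6 n + 1 exceeds the bound 3 n. *)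
have [g' [c' [hg' gc' c0']]] := H (3 * n)%N.
by have := lin_kdv_weight_bound hg' gc' c0'; lia.
Qed.
End RationalSolutions.

(** * Rigidity of the KdV face *)
Section FaceRigidity.
Variable F : numClosedFieldType.
Local Notation "p %:F" := (tofrac p).
Implicit Types (p q : {poly F}).
Local Notation pface t := (hirota_face (@deriv F) 'X t%:P).
Local Notation fface t := (hirota_face (@fderiv F) 'X%:F t%:P%:F).

Lemma tofrac_hirota_face (t : F) M N p q :
  (pface t M N p q)%:F = fface t M N p%:F q%:F.
Proof.
rewrite /hirota_face /wtz !fderiv_poly -!(rmorph_nat (@tofrac {poly F})).
rewrite -!(tofracM, tofracB) !fderiv_poly.
by rewrite -!(tofracM, tofracB, tofracD).
Qed.

(** If s were even, g = (phi/theta)' would be a solution of the linearised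
    equation whose leading coefficient at infinity, - s times that of
    phi/theta, is nonzero; [lin_kdv_even_eq0] forbids this. *)
Lemma face_rigidity (t : F) (theta phi : {poly F}) (M m s : nat) :
  t != 0 -> size theta = (m + s).+1 -> size phi = m.+1 ->
  pface t (M + s) (M + s) theta theta = 0 -> pface t M (M + s) phi theta = 0 ->
  (0 < s)%N -> odd s.
Proof.
move=> t0 sth sphi /(congr1 (@tofrac _)) h1 /(congr1 (@tofrac _)) h2 s0.
rewrite !tofrac_hirota_face tofrac0 in h1 h2.
have th0 : theta != 0 by rewrite -size_poly_eq0 sth.
have thF : theta%:F != 0 by rewrite tofrac_eq0.
have two0 : 2%:R != 0 :> {fraction {poly F}}.
  by rewrite -(rmorph_nat (@tofrac {poly F})) tofrac_eq0 -(rmorph_nat (@polyC F)) polyC_eq0 Num.Theory.pnatr_eq0.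
pose l := theta^`()%:F / theta%:F; pose f := phi%:F / theta%:F.
have lE : fderiv theta%:F = l * theta%:F by rewrite fderiv_poly /l (divfK thF).
have cst := fderiv_const t; have dX := fderiv_X F.
have hk := hirota_face_kdv (@fderivD F) (@fderivM F) dX cst thF two0 lE h1.
have fE : phi%:F = f * theta%:F by rewrite /f (divfK thF).
rewrite fE in h2.
have hl := hirota_face_lin_kdv (@fderivD F) (@fderivM F) dX thF two0 lE h1 h2.
apply: contraT => so.
have fa : at_infty f s (lead_coef phi / lead_coef theta).
  pose c := (lead_coef theta)^-1.
  have c0 : c != 0 by rewrite invr_eq0 lead_coef_eq0.
  exists m, (c *: phi), (c *: theta); rewrite !size_scale // sphi sth; split=> //.
  - by rewrite coefZ mulrC lead_coefE sphi.
  - by rewrite coefZ /c lead_coefE sth mulVf // -sth -lead_coefE lead_coef_eq0.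
  apply: frac_eq => //; first by rewrite scaler_eq0 negb_or c0.
  by rewrite -!mul_polyC; ring.
have := lin_kdv_even_eq0 t0 sth hk so hl (at_infty_deriv fa).
move/eqP; rewrite !mulf_eq0 oppr_eq0 Num.Theory.pnatr_eq0 invr_eq0 !lead_coef_eq0.
by rewrite (negbTE th0) -size_poly_eq0 sphi -leqn0 leqNgt s0.
Qed.

End FaceRigidity.

(** * Faces of polynomials in two variables *)
Lemma big_ord2 (T : Type) (idx : T) (op : Monoid.law idx) (G : 'I_2 -> T) :
  \big[op/idx]_(i < 2) G i = op (G 0) (G 1).
Proof.
rewrite !big_ord_recl big_ord0 Monoid.mulm1.
by congr (op (G _) (G _)); apply: val_inj.
Qed.

Lemma mnm2P (m m' : 'X_{1..2}) : m 0 = m' 0 -> m 1 = m' 1 -> m = m'.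
Proof.
move=> e0 e1; apply/mnmP => i.
by case: i => -[|[|//]] lti; [move: e0 | move: e1]; congr (m _ = m' _); apply: val_inj.
Qed.

Section Faces.
Variable F : numClosedFieldType.
Implicit Types (f g : {mpoly F[2]}) (m : 'X_{1..2}).
Variables p q : nat.

Definition weight m : nat := (p * m 0%R + q * m 1%R)%N.

(** Substitution of L^p for z and w L^q for w, a polynomial in L over F[w]: its
    degree in L is the largest weight, and the coefficient of L^W is the part
    of weight W restricted to z = 1. *)
Definition wexp : {mpoly F[2]} -> {poly {poly F}} :=
  mmap (polyC \o polyC) (fun i : 'I_2 => if i == 0 then 'X^p else 'X%:P * 'X^q).

Lemma wexpM f g : wexp (f * g) = wexp f * wexp g.
Proof. exact: rmorphM. Qed.

Lemma wexpD f g : wexp (f + g) = wexp f + wexp g.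
Proof. exact: raddfD. Qed.

Lemma wexp_mono c m : wexp (c *: 'X_[m]) = (c *: 'X^(m 1))%:P * 'X^(weight m).
Proof.
rewrite /wexp mmapZ mmapX /mmap1 big_ord2 /= exprMn -!exprM.
by rewrite -mul_polyC polyCM /weight exprD rmorphXn /=; ring.
Qed.

Lemma coef_wexp f W :
  (wexp f)`_W = \sum_(m <- msupp f | weight m == W) f@_m *: 'X^(m 1).
Proof.
rewrite {1}(mpolyE f) /wexp raddf_sum /= coef_sum [RHS]big_mkcond /=.
apply: eq_bigr => m _; rewrite -/(wexp _) wexp_mono coefCM coefXn eq_sym.
by case: eqP => _; rewrite ?mulr1 ?mulr0.
Qed.

Lemma wexp_bound W f : {in msupp f, forall m, weight m <= W}%N ->
  (size (wexp f) <= W.+1)%N.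
Proof.
move=> fW; apply/leq_sizeP => j ltWj; rewrite coef_wexp big_seq_cond big1 // => m.
by case/andP => /fW mW /eqP mj; move: ltWj; rewrite -mj ltnNge mW.
Qed.

Lemma face_supp f W b : (wexp f)`_W`_b != 0 ->
  exists2 m, m \in msupp f & weight m = W /\ m 1 = b.
Proof.
rewrite coef_wexp coef_sum => nz.
have /hasP[m mf /andP[/eqP mW mb]] :
    has (fun m => (weight m == W) && ((f@_m *: 'X^(m 1))`_b != 0)) (msupp f).
  apply: contraNT nz => /hasPn H; rewrite big_seq_cond big1 // => m /andP[/H + mW].
  by rewrite mW /= negbK => /eqP.
exists m => //; split=> //; apply: contraNeq mb => mb.
by rewrite coefZ coefXn [b == _]eq_sym (negbTE mb) mulr0.
Qed.

Hypothesis p0 : (0 < p)%N.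

(** For p > 0 the weight and the exponent of w determine the monomial, so
    restricting to z = 1 loses nothing. *)
Lemma face_coef f m : (wexp f)`_(weight m)`_(m 1) = f@_m.
Proof.
transitivity ((\sum_(m' <- msupp f) f@_m' *: 'X_[m'])@_m); last by rewrite -mpolyE.
rewrite coef_wexp coef_sum raddf_sum /= big_mkcond /=.
apply: eq_bigr => m' _; rewrite mcoeffZ mcoeffX; case: (altP eqP) => [mw|mw].
  rewrite coefZ coefXn; congr (_ * _%:R); congr nat_of_bool.
  apply/eqP/eqP => [m1|->] //; apply: mnm2P => //.
  by move: mw; rewrite /weight m1 => /addIn/eqP; rewrite eqn_mul2l eqn0Ngt p0 => /eqP.
by case: (m' =P m) mw => [->|_ _]; rewrite ?eqxx // mulr0.
Qed.

Lemma wexp_bound_inv W f : (size (wexp f) <= W.+1)%N ->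
  {in msupp f, forall m, weight m <= W}%N.
Proof.
move=> /leq_sizeP fW m; rewrite mcoeff_msupp -face_coef leqNgt.
by apply: contraNN => /fW ->; rewrite coef0.
Qed.

Lemma wexp_deriv1 f W : ('X^q * wexp f^`M(1))`_W = ((wexp f)`_W)^`().
Proof.
elim/mpolyind: f => [|c m f _ _ IH].
  by rewrite mderiv0 /wexp raddf0 mulr0 coef0 deriv0.
rewrite mderivD mderivZ mderivX scalerA !wexpD mulrDr !coefD derivD IH; congr (_ + _).
rewrite !wexp_mono mulrCA !coefCM -exprD !coefXn !mulr_natr derivMn derivZ derivXn.
case m1 : (m 1) => [|k]; first by rewrite mulr0n scale0r mul0rn mulr0n scaler0 mul0rn.
rewrite mnmBE mnm1E eqxx m1 subn1 /= -scalerMnl -scalerMnr; congr (_ *+ nat_of_bool (_ == _)).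
by rewrite /weight !mnmBE !mnm1E m1 /= subn0 subn1 /= mulnS; lia.
Qed.

(** Euler's identity p z f_z + q w f_w = W f for the part of weight W.  The
    factor L^p compensates the weight lost by differentiating in z. *)
Lemma wexp_deriv0 f W : p%:R *: ('X^p * wexp f^`M(0))`_W
   = W%:R *: (wexp f)`_W - q%:R *: ('X * ((wexp f)`_W)^`()).
Proof.
elim/mpolyind: f => [|c m f _ _ IH].
  by rewrite mderiv0 /wexp raddf0 mulr0 coef0 deriv0 mulr0 !scaler0 subrr.
rewrite mderivD mderivZ mderivX scalerA !wexpD mulrDr !coefD derivD mulrDr !scalerDr opprD.
rewrite addrACA IH; congr (_ + _).
rewrite !wexp_mono mulrCA !coefCM -exprD !coefXn.
have Xd b : 'X * ('X^b : {poly F})^`() = b%:R *: 'X^b.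
  by case: b => [|b]; rewrite derivXn ?mulr0n ?mulr0 ?scale0r // mulrnAr -exprS scaler_nat.
have [m0|m0] := posnP (m 0).
  rewrite m0 mulr0 scale0r mul0r scaler0.
  case: (W =P weight m) => [->|_]; last by rewrite !mulr0 deriv0 mulr0 !scaler0 subrr.
  by rewrite !mulr1 derivZ -scalerAr Xd /weight m0 muln0 add0n !scalerA natrM mulrAC subrr.
have -> : (p + weight (m - U_(0%R)) = weight m)%N.
  by rewrite /weight !mnmBE !mnm1E /= subn0; case: (m 0) m0 => // k _; lia.
rewrite mnmBE mnm1E /= subn0.
case: (W =P weight m) => [->|_]; last by rewrite !mulr0 deriv0 mulr0 !scaler0 subrr.
rewrite !mulr1 derivZ -scalerAr Xd /weight !scalerA -scalerBl natrD !natrM.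
by congr (_ *: _); ring.
Qed.

(** The derivative in x, as z = x + i y and w = x - i y. *)
Definition dx f : {mpoly F[2]} := f^`M(0) + f^`M(1).

Definition laplace_zw f g : {mpoly F[2]} :=
  f^`M(0)^`M(1) * g + f * g^`M(0)^`M(1) - f^`M(0) * g^`M(1) - f^`M(1) * g^`M(0).

Definition quartic_x f g : {mpoly F[2]} :=
  iter 4 dx f * g - 4%:R * (iter 3 dx f * dx g) + 6%:R * (iter 2 dx f * iter 2 dx g)
  - 4%:R * (dx f * iter 3 dx g) + f * iter 4 dx g.

(** The bound says that f has weight at most W - k; multiplying by L^k
    avoids truncated subtraction.  The loss k is the weight removed by
    the derivatives. *)
Definition below k W f := (size ('X^k * wexp f)%R <= W.+1)%N.
Definition top k W f : {poly F} := ('X^k * wexp f)`_W.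

Lemma below0 W f : (size (wexp f) <= W.+1)%N -> below 0 W f.
Proof. by rewrite /below expr0 mul1r. Qed.

Lemma top0 W f : top 0 W f = (wexp f)`_W.
Proof. by rewrite /top expr0 mul1r. Qed.

Lemma belowM k l W V f g : below k W f -> below l V g ->
  below (k + l) (W + V) (f * g) /\ top (k + l) (W + V) (f * g) = top k W f * top l V g.
Proof. by rewrite /below /top wexpM exprD mulrACA; apply: coef_topM. Qed.

Lemma below_deriv1 k W f : below k W f ->
  below (k + q) W f^`M(1) /\ top (k + q) W f^`M(1) = (top k W f)^`().
Proof.
have E j : top (k + q) j f^`M(1) = (top k j f)^`().
  rewrite /top exprD -mulrA coefXnM [in RHS]coefXnM; case: ltnP => _; first by rewrite deriv0.
  exact: wexp_deriv1.
move=> /leq_sizeP fW; split; last exact: E.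
by apply/leq_sizeP => j /fW; rewrite -/(top k j f) -/(top _ j _) E => ->; rewrite deriv0.
Qed.

Lemma natr_neq0 k : (0 < k)%N -> k%:R != 0 :> F.
Proof. by rewrite Num.Theory.pnatr_eq0 -lt0n. Qed.

Lemma below_deriv0 k W f : below k W f -> below (k + p) W f^`M(0).
Proof.
move=> /leq_sizeP fW; apply/leq_sizeP => j Wj.
rewrite exprD -mulrA coefXnM; case: ltnP => // kj.
have fj : (wexp f)`_(j - k) = 0 by have := fW j Wj; rewrite coefXnM ltnNge kj.
have := wexp_deriv0 f (j - k); rewrite fj deriv0 mulr0 !scaler0 subrr => /eqP.
by rewrite scaler_eq0 (negbTE (natr_neq0 p0)) => /eqP.
Qed.

Hypothesis qp : (q <= p)%N.

(** As q <= p, differentiating in x lowers weights by at least q; for q < p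
    only the w-derivative loses so little. *)
Lemma below_dx k W f : below k W f ->
  below (k + q) W (dx f) /\ ((q < p)%N -> top (k + q) W (dx f) = (top k W f)^`()).
Proof.
move=> fW; have [b1 t1] := below_deriv1 fW; have /leq_sizeP b0 := below_deriv0 fW.
have E j : top (k + q) j f^`M(0) = top (k + p) (j + (p - q)) f^`M(0).
  have e : (k + p = (p - q) + (k + q))%N by move: qp; lia.
  by rewrite /top [in RHS]e (exprD _ (p - q)) -mulrA [in RHS]coefXnM ltnNge leq_addl /= addnK.
rewrite /below /top /dx wexpD mulrDr; split.
  apply: leq_trans (size_polyD _ _) _; rewrite geq_max [X in _ && X]b1 andbT.
  apply/leq_sizeP => j Wj; rewrite -/(top _ _ _) E; apply: b0.
  exact: leq_trans Wj (leq_addr _ _).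
move=> ltqp; rewrite coefD -!/(top _ _ _) t1 E [X in X + _]b0 ?add0r //.
by move: ltqp; lia.
Qed.

Lemma below_iter_dx k W f i : below k W f -> below (i * q + k) W (iter i dx f) /\
  ((q < p)%N -> top (i * q + k) W (iter i dx f) = iter i (@deriv F) (top k W f)).
Proof.
move=> fW; elim: i => [|i [bi ti]]; first by rewrite mul0n.
have [b t] := below_dx bi; have e : (i.+1 * q + k = i * q + k + q)%N by rewrite mulSn; lia.
by rewrite e; split=> // ltqp; rewrite t // ti.
Qed.

Definition has_top k W f X := below k W f /\ top k W f = X.

Lemma has_topD k W f g X Y : has_top k W f X -> has_top k W g Y ->
  has_top k W (f + g) (X + Y).
Proof.
rewrite /has_top /below /top wexpD mulrDr coefD => -[bf ->] [bg ->]; split=> //.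
by apply: leq_trans (size_polyD _ _) _; rewrite geq_max bf bg.
Qed.

Lemma has_topN k W f X : has_top k W f X -> has_top k W (- f) (- X).
Proof.
by rewrite /has_top /below /top /wexp raddfN mulrN size_polyN coefN => -[bf ->].
Qed.

Lemma has_topB k W f g X Y : has_top k W f X -> has_top k W g Y ->
  has_top k W (f - g) (X - Y).
Proof. by move=> hf /has_topN; apply: has_topD. Qed.

Lemma has_top_nat k W f X c : has_top k W f X -> has_top k W (c%:R * f) (c%:R * X).
Proof.
rewrite !mulr_natl; elim: c => [|c IH] h.
  by rewrite /has_top /below /top /wexp !mulr0n raddf0 mulr0 size_poly0 coef0.
by rewrite !mulrS; apply: has_topD => //; apply: IH.
Qed.

Lemma has_topM k l W V f g X Y : has_top k W f X -> has_top l V g Y ->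
  has_top (k + l) (W + V) (f * g) (X * Y).
Proof. by move=> [bf <-] [bg <-]; apply: belowM. Qed.

Section HirotaFace.
Variables (W V : nat) (f g : {mpoly F[2]}).
Hypotheses (fW : (size (wexp f) <= W.+1)%N) (gV : (size (wexp g) <= V.+1)%N).
Let X := (wexp f)`_W.
Let Y := (wexp g)`_V.

(** The multiple p z f_z of the z-derivative of a face, by Euler's identity. *)
Definition wt_deriv (U : nat) (Z : {poly F}) : {poly F} :=
  U%:R *: Z - q%:R *: ('X * Z^`()).

(** The bilinear form p D_z D_w evaluated on faces. *)
Definition laplace_face : {poly F} :=
  (wt_deriv W X)^`() * Y + X * (wt_deriv V Y)^`() - wt_deriv W X * Y^`()
  - X^`() * wt_deriv V Y.

Lemma laplace_top :
  exists2 Z, has_top (p + q) (W + V) (laplace_zw f g) Z & p%:R *: Z = laplace_face.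
Proof.
have bf := below0 fW; have bg := below0 gV.
have bf0 := below_deriv0 bf; have bg0 := below_deriv0 bg.
have [bf1 tf1] := below_deriv1 bf; have [bg1 tg1] := below_deriv1 bg.
have hf01 := below_deriv1 bf0; have hg01 := below_deriv1 bg0.
have zf : p%:R *: top p W f^`M(0) = wt_deriv W X := wexp_deriv0 f W.
have zg : p%:R *: top p V g^`M(0) = wt_deriv V Y := wexp_deriv0 g V.
rewrite !top0 add0n in tf1 tg1 bf1 bg1 bf0 bg0 hf01 hg01 *.
have h1 := has_topM hf01 (conj bg (top0 _ _)); rewrite addn0 in h1.
have h2 := has_topM (conj bf (top0 _ _)) hg01; rewrite add0n in h2.
have h3 := has_topM (conj bf0 erefl) (conj bg1 tg1).
have h4 := has_topM (conj bf1 tf1) (conj bg0 erefl); rewrite addnC in h4.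
eexists; first exact: has_topB (has_topB (has_topD h1 h2) h3) h4.
rewrite /laplace_face -zf -zg /X /Y !derivZ -!mul_polyC; ring.
Qed.

Lemma iter_dx_top i j : (i + j = 4)%N ->
  has_top (4 * q) (W + V) (iter i dx f * iter j dx g)
    (top (i * q) W (iter i dx f) * top (j * q) V (iter j dx g)).
Proof.
move=> ij; rewrite -ij mulnDl; apply: has_topM; split=> //.
  by have [] := below_iter_dx i (below0 fW); rewrite addn0.
by have [] := below_iter_dx j (below0 gV); rewrite addn0.
Qed.

Lemma quartic_top : exists2 Z, has_top (4 * q) (W + V) (quartic_x f g) Z &
  ((q < p)%N -> Z = iter 4 (@deriv F) X * Y - 4%:R * (iter 3 (@deriv F) X * Y^`())
     + 6%:R * (X^`()^`() * Y^`()^`()) - 4%:R * (X^`() * iter 3 (@deriv F) Y)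
     + X * iter 4 (@deriv F) Y).
Proof.
have h i j := @iter_dx_top i j.
eexists.
  exact: (has_topD (has_topB (has_topD (has_topB (h 4 0 erefl)
    (has_top_nat 4 (h 3 1 erefl))) (has_top_nat 6 (h 2 2 erefl)))
    (has_top_nat 4 (h 1 3 erefl))) (h 0 4 erefl)).
move=> qp'.
have Ef i : top (i * q) W (iter i dx f) = iter i (@deriv F) X.
  by have [_] := below_iter_dx i (below0 fW); rewrite addn0 top0 => ->.
have Eg i : top (i * q) V (iter i dx g) = iter i (@deriv F) Y.
  by have [_] := below_iter_dx i (below0 gV); rewrite addn0 top0 => ->.
by rewrite !Ef !Eg.
Qed.

End HirotaFace.
End Faces.

(** * The equation on faces *)
Section FaceEquations.
Variable F : numClosedFieldType.
Implicit Types (f g : {mpoly F[2]}) (m : 'X_{1..2}).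

(** The bilinear form of 4 D_z D_w - (D_z + D_w)^4. *)
Definition hirota_zw f g : {mpoly F[2]} := 4%:R * laplace_zw f g - quartic_x f g.

Section Face.
Variables (p q W V : nat) (f g : {mpoly F[2]}).
Hypotheses (q0 : (0 < q)%N) (qp : (q <= p)%N).
Hypotheses (fW : (size (wexp p q f) <= W.+1)%N) (gV : (size (wexp p q g) <= V.+1)%N).
Hypothesis fg : hirota_zw f g = 0.
Let p0 : (0 < p)%N. Proof. exact: leq_trans qp. Qed.

(** D_z D_w loses the weight p + q, but D_x^4 loses at least 4 q, which is more
    when p < 3 q. *)
Lemma face_laplace : (p < 3 * q)%N -> laplace_face p q W V f g = 0.
Proof.
move=> p3q; have [Z [bZ tZ] <-] := laplace_top p0 fW gV.
have [Z' [bZ' tZ'] _] := quartic_top p0 qp fW gV.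
have := has_top_nat 4 (conj bZ tZ); move/eqP: fg; rewrite /hirota_zw subr_eq0 => /eqP ->.
case=> _; rewrite /top.
have e : (4 * q = (3 * q - p) + (p + q))%N by move: p3q; lia.
have /leq_sizeP/(_ (W + V + (3 * q - p))%N) := bZ'.
rewrite e exprD -mulrA coefXnM [X in if X then _ else _]ltnNge leq_addl /= addnK.
move=> -> //; last by move: p3q; lia.
move/esym/eqP; rewrite -(rmorph_nat (@polyC F)) mul_polyC scaler_eq0.
by rewrite (negbTE (natr_neq0 _ _)) //= => /eqP->; rewrite scaler0.
Qed.

End Face.

(** At weights (3, 1) both terms lose the weight 4, and D_x^4 does so through
    D_w^4 only. *)
Lemma face_kdv W V f g : (size (wexp 3 1 f) <= W.+1)%N -> (size (wexp 3 1 g) <= V.+1)%N ->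
  hirota_zw f g = 0 ->
  hirota_face (@deriv F) 'X (4%:R / 3%:R)%:P W V (wexp 3 1 f)`_W (wexp 3 1 g)`_V = 0.
Proof.
move=> fW gV fg; have [Z [bZ tZ] ZE] := laplace_top (isT : 0 < 3)%N fW gV.
have [Z' [bZ' tZ'] /(_ isT) ZE'] := quartic_top (isT : 0 < 3)%N (isT : 1 <= 3)%N fW gV.
have [_] := has_top_nat 4 (conj bZ tZ); move/eqP: fg; rewrite /hirota_zw subr_eq0 => /eqP ->.
rewrite tZ' ZE' => E.
rewrite /hirota_face.
have wE U H : wtz (@deriv F) 'X U H = wt_deriv 1 U H.
  by rewrite /wtz /wt_deriv scale1r scaler_nat mulr_natl.
rewrite !wE.
set L := (X in _%:P * X - _); have LE : L = 3%:R *: Z by rewrite ZE /L /laplace_face.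
rewrite [in X in _ - X]E LE -mul_polyC mulrA -polyCM divfK ?natr_neq0 //.
by rewrite (rmorph_nat (@polyC F)) subrr.
Qed.

Lemma coefXderiv (P : {poly F}) b : ('X * P^`())`_b = b%:R * P`_b.
Proof. by rewrite mulrC coefMX; case: b => [|b]; rewrite ?mul0r //= coef_deriv mulr_natl. Qed.

(** The equation is P^2 times (w P'/P)' = 0, so w P' is a multiple of P, that
    is, P is a monomial. *)
Lemma wronskian_eq_monomial (P : {poly F}) b b' :
  P * P^`() + 'X * (P * P^`()^`()) - 'X * P^`() ^+ 2 = 0 ->
  P`_b != 0 -> P`_b' != 0 -> b = b'.
Proof.
move=> H; pose k := (size P).-1; pose Y := 'X * P^`() - k%:R *: P.
have [P0|P0] := eqVneq P 0; first by rewrite P0 coef0 eqxx.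
have sP : size P = k.+1 by rewrite prednK // size_poly_gt0.
(* With k the degree of P, Y = w P' - k P satisfies w Y'/Y = w P'/P.  Were Y
   nonzero, comparing leading terms would give it the degree k, but its
   coefficient of degree k vanishes. *)
have YE : 'X * Y^`() * P = Y * ('X * P^`()).
  apply/eqP; rewrite -subr_eq0 -[X in _ == X](mulr0 'X) -H; apply/eqP.
  by rewrite /Y !(derivB, derivM, derivX, derivZ) -!mul_polyC; ring.
have Yk : Y`_k = 0 by rewrite coefB coefXderiv coefZ subrr.
have Y0 : Y = 0.
  apply/eqP/negPn/negP => Y0; have sY : size Y = (size Y).-1.+1 by rewrite prednK // size_poly_gt0.
  set e := (size Y).-1 in sY.
  have [s1 c1] := coef_topXderiv (eq_leq sY); have [s2 c2] := coef_topXderiv (eq_leq sP).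
  have [_ c3] := coef_topM s1 (eq_leq sP); have [_ c4] := coef_topM (eq_leq sY) s2.
  have := congr1 (fun Z : {poly F} => Z`_(e + k)) YE; rewrite c3 c4 c1 c2 mulrCA -mulrA.
  have nzY : Y`_e != 0 by rewrite -lead_coefE lead_coef_eq0.
  have nzP : P`_k != 0 by rewrite -lead_coefE lead_coef_eq0.
  move/(mulIf (mulf_neq0 nzY nzP))/eqP; rewrite Num.Theory.eqr_nat => /eqP ek.
  by move: nzY; rewrite ek Yk eqxx.
have H1 c : P`_c != 0 -> c = k.
  move=> Pc; have := congr1 (fun Z : {poly F} => Z`_c) Y0.
  rewrite coefB coefXderiv coefZ coef0 -mulrBl => /eqP.
  by rewrite mulf_eq0 (negbTE Pc) orbF subr_eq0 Num.Theory.eqr_nat => /eqP.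
by move=> /H1 -> /H1 ->.
Qed.

Section FaceLaplace.
Variables (p q W V : nat) (f g : {mpoly F[2]}).
Hypotheses (q0 : (0 < q)%N) (qp : (q <= p)%N) (p3q : (p < 3 * q)%N).
Hypotheses (fW : (size (wexp p q f) <= W.+1)%N) (gV : (size (wexp p q g) <= V.+1)%N).
Let p0 : (0 < p)%N. Proof. exact: leq_trans qp. Qed.

(** Substituting Euler's identity, the equation D_z D_w X X = 0 on the face X
    becomes [wronskian_eq_monomial] for X. *)
Lemma face_monomial m m' : hirota_zw f f = 0 -> m \in msupp f -> m' \in msupp f ->
  weight p q m = W -> weight p q m' = W -> m = m'.
Proof.
move=> ff mf mf' mW mW'.
have L := face_laplace q0 qp fW fW ff p3q.
have m1 : m 1 = m' 1.
  apply: (@wronskian_eq_monomial (wexp p q f)`_W).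
  - apply/eqP; rewrite -(@mulrI_eq0 _ (-2%:R * q%:R)%:P); last first.
      by apply/mulfI; rewrite polyC_eq0 mulf_neq0 ?oppr_eq0 ?natr_neq0.
    move: L; rewrite /laplace_face /wt_deriv.
    rewrite !(derivB, derivM, derivX, derivZ) -!mul_polyC => L.
    by rewrite -[X in _ == X]L polyCM polyCN; apply/eqP; ring.
  - by rewrite -mW face_coef // -mcoeff_msupp.
  - by rewrite -mW' face_coef // -mcoeff_msupp.
apply: mnm2P => //; move: mW'; rewrite -mW /weight m1 => /addIn/eqP.
by rewrite eqn_mul2l eqn0Ngt p0 /= => /eqP.
Qed.

(** Against the monomial z^n w^n the form D_z D_w is diagonal: it multiplies
    z^a w^b by (a - n) (b - n), up to a monomial factor.  So only a = n or
    b = n is possible on the face. *)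
Lemma face_lin n c m : c != 0 -> V = (p * n + q * n)%N -> (wexp p q g)`_V = c *: 'X^n ->
  hirota_zw f g = 0 -> m \in msupp f -> weight p q m = W -> m 0 = n \/ m 1 = n.
Proof.
move=> c0 VE gE fg mf mW; set X := (wexp p q f)`_W.
have L := face_laplace q0 qp fW gV fg p3q.
rewrite /laplace_face gE -/X in L.
(* T is w d/dw; Z is the quotient of the face equation by c w^(n-1), and its
   coefficient of index b is p (a - n) (b - n) times that of X. *)
pose T (P : {poly F}) := 'X * P^`().
pose Z : {poly F} := (W%:R *: T X - q%:R *: T (T X)) + (p * n * n)%:R *: X
   - n%:R *: (W%:R *: X - q%:R *: T X) - (p * n)%:R *: T X.
have XnT : 'X * ('X^n)^`() = n%:R *: 'X^n :> {poly F}.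
  by case: (n) => [|k]; rewrite derivXn ?mulr0n ?mulr0 ?scale0r // mulrnAr -exprS scaler_nat.
have wV : wt_deriv q V (c *: 'X^n) = (p * n)%:R *: (c *: 'X^n).
  rewrite /wt_deriv derivZ -scalerAr XnT !scalerA -scalerBl VE; congr (_ *: _).
  by rewrite natrD !natrM; ring.
rewrite wV in L.
have cXn0 : c *: 'X^n != 0 :> {poly F} by rewrite scaler_eq0 negb_or c0 monic_neq0 ?monicXn.
have Z0 : Z = 0.
  apply: (mulfI cXn0); rewrite mulr0 -[RHS](mulr0 'X) -L /Z /T /wt_deriv.
  move: XnT; rewrite !(derivB, derivM, derivX, derivZ) -!mul_polyC !natrM !polyCM.
  move: ('X^n) ('X^n)^`() => E E' EE; set A := (W%:R%:P * X - q%:R%:P * ('X * X^`())).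
  transitivity (c%:P * E * (W%:R%:P * ('X * X^`())
      - q%:R%:P * ('X * (1 * X^`() + 'X * X^`()^`())))
    + (X * (p%:R%:P * n%:R%:P * c%:P) - A * c%:P) * (n%:R%:P * E)
    - 'X * X^`() * (p%:R%:P * n%:R%:P * (c%:P * E))).
    by rewrite /A; ring.
  by rewrite -EE; ring.
have := congr1 (fun Q : {poly F} => Q`_(m 1)) Z0.
rewrite /Z /T !(coefB, coefD, coefZ, coefXderiv) coef0 -mW /weight natrD !natrM.
have Xm : X`_(m 1) != 0 by rewrite /X -mW face_coef // -mcoeff_msupp.
move: (X`_(m 1)) Xm => x x0 E.
have : p%:R * ((m 0)%:R - n%:R) * ((m 1)%:R - n%:R) * x = 0 by rewrite -[RHS]E; ring.
move/eqP; rewrite !mulf_eq0 (negbTE x0) orbF (negbTE (natr_neq0 _ p0)) /=.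
by rewrite !subr_eq0 !Num.Theory.eqr_nat => /orP[/eqP|/eqP]; [left | right].
Qed.

End FaceLaplace.
End FaceEquations.

(** * Newton polygon of a solution and uniqueness *)
Definition mk2 (a b : nat) : 'X_{1..2} := [multinom [tuple a; b]].

Lemma mk2_0 a b : mk2 a b 0 = a. Proof. by []. Qed.
Lemma mk2_1 a b : mk2 a b 1 = b. Proof. by []. Qed.

Lemma mk2P (m : 'X_{1..2}) a b : m 0 = a -> m 1 = b -> m = mk2 a b.
Proof. by move=> ma mb; apply: mnm2P; rewrite ?mk2_0 ?mk2_1. Qed.

Lemma seq_argmin (T : eqType) (f : T -> rat) (s : seq T) : s != [::] ->
  exists2 x, x \in s & {in s, forall y, (f x <= f y)%R}.
Proof.
elim: s => // x [_ _|y s /(_ isT) [z zs zmin] _].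
  by exists x; rewrite ?mem_head // => y; rewrite inE => /eqP->.
have [xz|zx] := Order.TotalTheory.leP (f x) (f z).
  exists x; rewrite ?mem_head // => t; rewrite inE => /predU1P[->//|/zmin].
  exact: Order.POrderTheory.le_trans.
exists z; first by rewrite inE zs orbT.
move=> t; rewrite inE => /predU1P[->|/zmin //].
exact: Order.POrderTheory.ltW.
Qed.

Section TauStructure.
Variable F : numClosedFieldType.
Implicit Types (f g T : {mpoly F[2]}) (m : 'X_{1..2}).
Variable n : nat.

Definition swap_sym T := forall a b, T@_(mk2 a b) = T@_(mk2 b a).
Definition even_deg T := {in msupp T, forall m, ~~ odd (m 0%R + m 1%R)}.
Definition deg_le d T := {in msupp T, forall m, m 0%R + m 1%R <= d}%N.

(** The hypotheses on tau in the coordinates z and w. *)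
Definition zw_tau T := [/\ deg_le (2 * n) T,
  exists2 m, m \in msupp T & (m 0%R + m 1%R = 2 * n)%N,
  swap_sym T, even_deg T & hirota_zw T T = 0].

(** The face for weights (1, 1) is a monomial and is symmetric, so its two
    exponents agree. *)
Lemma zw_tau_top T : zw_tau T -> T@_(mk2 n n) != 0 /\
  {in msupp T, forall m, (m 0%R + m 1%R = 2 * n)%N -> m = mk2 n n}.
Proof.
case=> dT [m mT mn] symT _ TT.
have bT : (size (wexp 1 1 T) <= (2 * n).+1)%N.
  by apply: wexp_bound => m' /dT; rewrite /weight !mul1n.
have H : {in msupp T, forall m', (m' 0%R + m' 1%R = 2 * n)%N -> m' = mk2 n n}.
  move=> m' mT' mn'; have m'E : m' = mk2 (m' 0) (m' 1) by exact: mk2P.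
  have mS : mk2 (m' 1) (m' 0) \in msupp T by rewrite mcoeff_msupp symT -m'E -mcoeff_msupp.
  have := @face_monomial _ 1 1 (2 * n) T isT isT isT bT m' _ TT mT' mS.
  rewrite /weight !mul1n.
  rewrite ?mk2_0 ?mk2_1 [(m' 1%R + _)%N]addnC => /(_ mn' mn') e.
  have e01 : m' 0 = m' 1 by rewrite {1}e mk2_0.
  by apply: mk2P; move: mn'; rewrite -e01 addnn mul2n => /double_inj.
by split=> //; rewrite -(H m mT mn) -mcoeff_msupp.
Qed.

(** Otherwise some support point lies to the right of (n, n) and above the line
    of slope -3 through it.  The edge of the Newton polygon that leaves (n, n)
    to the right then has a slope -p/q with p < 3 q, against [face_monomial]. *)
Lemma zw_tau_weight31 T : zw_tau T -> {in msupp T, forall m, 3 * m 0%R + m 1%R <= 4 * n}%N.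
Proof.
move=> zT; have [Tn Ttop] := zw_tau_top zT; case: zT => dT _ _ _ TT.
move=> y yT; rewrite leqNgt; apply/negP => ybad.
have dy := dT y yT.
pose s := [seq m : 'X_{1..2} <- msupp T | (n < m 0%R)%N].
have yS : y \in s by rewrite mem_filter yT andbT; lia.
have s0 : s != [::] by apply: contraTneq yS => ->.
(* x is where the descent from (n, n), per unit of a, is the smallest; the
   line through (n, n) and x bounds the support from above. *)
have [x] := seq_argmin (fun m : 'X_{1..2} => (n - m 1%R)%:R / (m 0%R - n)%:R) s0.
rewrite mem_filter => /andP[nx xT] xmin.
pose p := (n - x 1%R)%N; pose q := (x 0%R - n)%N.
have dx := dT x xT.
have xmin' z : z \in msupp T -> (n < z 0%R)%N -> (p * (z 0%R - n) <= (n - z 1%R) * q)%N.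
  move=> zT nz; have := xmin z; rewrite mem_filter nz zT => /(_ isT).
  rewrite Num.Theory.ler_pdivrMr ?Num.Theory.ltr0n ?subn_gt0 // mulrAC.
  by rewrite Num.Theory.ler_pdivlMr ?Num.Theory.ltr0n ?subn_gt0 // -!natrM Num.Theory.ler_nat.
have nx2 : (x 0%R + x 1%R < 2 * n)%N.
  rewrite ltn_neqAle dx andbT; apply/eqP => /(Ttop x xT) xE.
  by move: nx; rewrite xE mk2_0 ltnn.
have q0 : (0 < q)%N by rewrite /q; lia.
have qp : (q <= p)%N by rewrite /p /q; lia.
have p3q : (p < 3 * q)%N.
  have ny : (n < y 0%R)%N by lia.
  have ny2 : (n - y 1%R < 3 * (y 0%R - n))%N by lia.
  rewrite ltnNge; apply/negP => pq; move: (xmin' y yT ny); apply/negP; rewrite -ltnNge.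
  by apply: (@leq_trans (3 * (y 0%R - n) * q)); [rewrite ltn_pmul2r | nia].
have bT : (size (wexp p q T) <= (p * n + q * n).+1)%N.
  apply: wexp_bound => z zT; rewrite /weight; have dz := dT z zT.
  have [nz|zn] := ltnP n (z 0%R); last by nia.
  have := xmin' z zT nz; move: dz; rewrite -/q; move: (p) (q) => P Q; nia.
have wn : weight p q (mk2 n n) = (p * n + q * n)%N by rewrite /weight mk2_0 mk2_1.
have wx : weight p q x = (p * n + q * n)%N by rewrite /weight /p /q; nia.
have nT : mk2 n n \in msupp T by rewrite mcoeff_msupp.
have := face_monomial q0 qp p3q bT TT nT xT wn wx.
by move/(congr1 (fun m : 'X_{1..2} => m 0)); rewrite mk2_0; lia.
Qed.

Lemma iter_dxD i f g : iter i (@dx F) (f + g) = iter i (@dx F) f + iter i (@dx F) g.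
Proof. by elim: i => //= i ->; rewrite /dx !mderivD addrACA. Qed.

Lemma iter_dxZ i c f : iter i (@dx F) (c *: f) = c *: iter i (@dx F) f.
Proof. by elim: i => //= i ->; rewrite /dx !mderivZ scalerDr. Qed.

Lemma iter_dxB i f g : iter i (@dx F) (f - g) = iter i (@dx F) f - iter i (@dx F) g.
Proof. by rewrite -scaleN1r iter_dxD iter_dxZ scaleN1r. Qed.

(** The form is bilinear and symmetric: its value at g - f and f + g is the
    difference of its values on the diagonal. *)
Lemma hirota_zw_polarization f g : hirota_zw f f = 0 -> hirota_zw g g = 0 ->
  hirota_zw (g - f) (f + g) = 0.
Proof.
move=> ff gg; transitivity (hirota_zw g g - hirota_zw f f); last by rewrite ff gg subrr.
rewrite /hirota_zw /laplace_zw /quartic_x -!(iterS 0 (@dx F)) !iter_dxB !iter_dxD.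
rewrite !(mderivB, mderivD).
move: (iter 1 _ f) (iter 2 _ f) (iter 3 _ f) (iter 4 _ f) => f1 f2 f3 f4.
move: (iter 1 _ g) (iter 2 _ g) (iter 3 _ g) (iter 4 _ g) => g1 g2 g3 g4.
ring.
Qed.

Lemma hirota_zwZ c f : hirota_zw (c *: f) (c *: f) = (c * c) *: hirota_zw f f.
Proof.
rewrite /hirota_zw /laplace_zw /quartic_x -!(iterS 0 (@dx F)) !iter_dxZ !mderivZ.
move: (iter 1 _ f) (iter 2 _ f) (iter 3 _ f) (iter 4 _ f) => f1 f2 f3 f4.
rewrite -!mul_mpolyC mpolyCM; ring.
Qed.

Lemma zw_tauZ c T : c != 0 -> zw_tau T -> zw_tau (c *: T).
Proof.
move=> c0 [dT [m mT mn] sT eT TT].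
have supp m' : (m' \in msupp (c *: T)) = (m' \in msupp T).
  by rewrite !mcoeff_msupp mcoeffZ mulf_eq0 (negbTE c0).
split.
- by move=> m'; rewrite supp; apply: dT.
- by exists m; rewrite ?supp.
- by move=> a b; rewrite !mcoeffZ sT.
- by move=> m'; rewrite supp; apply: eT.
by rewrite hirota_zwZ TT scaler0.
Qed.

Section SumFace.
Variables (S : {mpoly F[2]}) (p q : nat).
Hypotheses (p0 : (0 < p)%N).
Hypothesis Sw : {in msupp S, forall m, weight p q m <= p * n + q * n}%N.
Hypothesis Stop : {in msupp S, forall m, weight p q m = (p * n + q * n)%N -> m = mk2 n n}.

Lemma monomial_face : (wexp p q S)`_(p * n + q * n) = S@_(mk2 n n) *: 'X^n.
Proof.
apply/polyP => b; rewrite coefZ coefXn; have [->|bn] := eqVneq b n.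
  by rewrite mulr1 -(face_coef q p0) /weight mk2_0 mk2_1.
rewrite mulr0; apply/eqP/negPn/negP => /face_supp[m mS [mw mb]].
by move: bn; rewrite -mb (Stop mS mw) mk2_1 eqxx.
Qed.
End SumFace.

Section Deformation.
Variables (D S : {mpoly F[2]}).
Hypotheses (D2n : deg_le (2 * n) D) (Dn : D@_(mk2 n n) = 0).
Hypotheses (Dsym : swap_sym D) (Deven : even_deg D) (D0 : D != 0).
Hypotheses (Sn : S@_(mk2 n n) != 0) (S2n : deg_le (2 * n) S).
Hypothesis Stop : {in msupp S, forall m, (m 0%R + m 1%R = 2 * n)%N -> m = mk2 n n}.
Hypothesis S31 : {in msupp S, forall m, 3 * m 0%R + m 1%R <= 4 * n}%N.
Hypothesis DS : hirota_zw D S = 0.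

(** [face_lin] at weights (1, 1), where the face of S is a multiple of
    (z w)^n, leaves z^n w^k and z^k w^n, which the symmetry exchanges; k = n
    is excluded by the normalisation. *)
Lemma deformation_top : exists k, [/\ (k < n)%N, ~~ odd (n - k),
  deg_le (n + k) D & D@_(mk2 n k) != 0].
Proof.
have [d sD] : exists d, size (wexp 1 1 D) = d.+1.
  exists (size (wexp 1 1 D)).-1; rewrite prednK // size_poly_gt0.
  apply: contraNneq D0 => E; apply/eqP/mpolyP => m.
  by rewrite -(face_coef 1 (isT : 0 < 1)%N) E !coef0 mcoeff0.
have [m mD mw] : exists2 m, m \in msupp D & weight 1 1 m = d.
  have : lead_coef (lead_coef (wexp 1 1 D)) != 0 by rewrite !lead_coef_eq0 -size_poly_eq0 sD.
  rewrite [lead_coef (wexp _ _ _)]lead_coefE lead_coefE sD => /face_supp[m mD [mw _]].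
  by exists m.
have sS : (size (wexp 1 1 S) <= (1 * n + 1 * n).+1)%N.
  by apply: wexp_bound => y /S2n; rewrite /weight !mul1n; lia.
have fS : (wexp 1 1 S)`_(1 * n + 1 * n) = S@_(mk2 n n) *: 'X^n.
  apply: monomial_face => // y yS; rewrite /weight !mul1n => e.
  by apply: Stop => //; lia.
have := face_lin (isT : 0 < 1)%N (isT : 1 <= 1)%N (isT : 1 < 3 * 1)%N (eq_leq sD) sS Sn erefl fS DS mD mw.
have mDeg := wexp_bound_inv (isT : 0 < 1)%N (eq_leq sD).
have dD : deg_le d D by move=> y /mDeg; rewrite /weight !mul1n.
move: mw; rewrite /weight !mul1n => mw mn.
have [k [kd kD]] : exists k, d = (n + k)%N /\ D@_(mk2 n k) != 0.
  case: mn => mn; [exists (m 1) | exists (m 0)]; split; try lia.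
    by rewrite -(mk2P mn erefl) -mcoeff_msupp.
  by rewrite Dsym -(mk2P erefl mn) -mcoeff_msupp.
exists k; rewrite -kd; split=> //.
  have := D2n mD; rewrite mw kd mul2n -addnn leq_add2l leq_eqVlt => /predU1P[kn|//].
  by move: kD; rewrite kn Dn eqxx.
have := Deven mD; rewrite mw kd; have := D2n mD; rewrite mw kd.
move: (n) => N kN; rewrite oddB ?oddD //; lia.
Qed.

(** [face_lin] applies to weight ratios p/q < 3 only; a ratio sufficiently
    close to 3 gives the bound at 3, since the exponents are bounded integers.
    On the extreme face a = n or b = n, and there the degree bound n + k gives
    a weight of at most p n + q k. *)
Lemma deformation_weight31 k : (k <= n)%N -> deg_le (n + k) D -> D@_(mk2 n k) != 0 ->
  {in msupp D, forall m, 3 * m 0%R + m 1%R <= 3 * n + k}%N.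
Proof.
move=> kn dD kD y yD; rewrite leqNgt; apply/negP => ybad.
have dy := dD y yD.
(* The weight of z^a w^b is q (3 a + b) - a, and q exceeds every exponent a
   of D, which is at most n + k: a unit of 3 a + b outweighs the defect a. *)
pose q := (4 * n).+1; pose p := (3 * q - 1)%N.
have q0 : (0 < q)%N by [].
have qp : (q <= p)%N by rewrite /p /q; lia.
have p3q : (p < 3 * q)%N by rewrite /p /q; lia.
have p0 : (0 < p)%N by exact: leq_trans qp.
have yw : (p * n + q * k < weight p q y)%N.
  rewrite /weight; have : (q * (3 * n + k).+1 <= q * (3 * y 0%R + y 1%R))%N by rewrite leq_mul2l ybad orbT.
  have y0 : (y 0%R < q)%N by rewrite /q; lia.
  move: y0; rewrite /p; move: (q) q0 (y 0%R) (y 1%R) => Q Q0 y0 y1; nia.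
have Sw : {in msupp S, forall m, 2 * weight p q m + (2 * n - (m 0%R + m 1%R)) <= 2 * (p * n + q * n)}%N.
  move=> m mS; have := S31 mS; have := S2n mS; rewrite /weight /p.
  move: (m 0%R) (m 1%R) => a b; move: (q) q0 => Q Q0; nia.
have sS : (size (wexp p q S) <= (p * n + q * n).+1)%N.
  by apply: wexp_bound => m /Sw; lia.
have fS : (wexp p q S)`_(p * n + q * n) = S@_(mk2 n n) *: 'X^n.
  apply: monomial_face => // m mS mw; apply: Stop => //.
  by have := Sw m mS; have := S2n mS; rewrite mw; lia.
have D0' : wexp p q D != 0.
  apply: contraNneq kD => E.
  by rewrite -(face_coef q p0) E !coef0.
have [d sD] : exists d, size (wexp p q D) = d.+1.
  by exists (size (wexp p q D)).-1; rewrite prednK // size_poly_gt0.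
have [m mD mw] : exists2 m, m \in msupp D & weight p q m = d.
  have : lead_coef (lead_coef (wexp p q D)) != 0 by rewrite !lead_coef_eq0.
  by rewrite [lead_coef (wexp _ _ _)]lead_coefE lead_coefE sD => /face_supp[m mD [mw _]]; exists m.
have yd := wexp_bound_inv p0 (eq_leq sD) yD.
have dm := dD m mD.
case: (face_lin q0 qp p3q (eq_leq sD) sS Sn erefl fS DS mD mw) => mn.
  have : (q * m 1%R <= q * k)%N by rewrite leq_mul2l; lia.
  by move: mw yd yw; rewrite /weight mn; lia.
have mk : (m 0%R <= k)%N by lia.
move: mw yd yw; rewrite /weight mn; move: mk kn qp.
move: (p) (q) (m 0%R) => P Q a; nia.
Qed.

End Deformation.

(** Points with 3 a + b = 3 n + k and a + b <= n + k have b <= k, so z^n w^k is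
    the term of top degree in w on this face. *)
Lemma size_face31 f k : deg_le (n + k) f -> f@_(mk2 n k) != 0 ->
  size (wexp 3 1 f)`_(3 * n + k) = k.+1.
Proof.
move=> df fk; apply/eqP; rewrite eqn_leq; apply/andP; split.
  apply/leq_sizeP => b kb; apply/eqP/negPn/negP => /face_supp[m mf [mw mb]].
  by have := df m mf; move: mw; rewrite /weight mb; lia.
rewrite ltnNge; apply: contra fk => /leq_sizeP/(_ k (leqnn k)).
have -> : (3 * n + k = weight 3 1 (mk2 n k))%N by rewrite /weight mk2_0 mk2_1 mul1n.
by rewrite -{2}(mk2_1 n k) face_coef // => ->.
Qed.

Lemma zw_tau_unique T T' : zw_tau T -> zw_tau T' -> T@_(mk2 n n) = T'@_(mk2 n n) ->
  T' = T.
Proof.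
move=> zT zT' TT'; pose D := T' - T; pose S := T + T'.
apply/eqP; rewrite -subr_eq0 -/D; apply/negPn/negP => D0.
have [Tn Ttop] := zw_tau_top zT; have [Tn' Ttop'] := zw_tau_top zT'.
have T31 := zw_tau_weight31 zT; have T31' := zw_tau_weight31 zT'.
case: zT zT' => dT _ sT eT TT [dT' _ sT' eT' TT2].
have Dsupp m : m \in msupp D -> m \in msupp T \/ m \in msupp T'.
  by move/msuppB_le; rewrite mem_cat => /orP[|]; [right | left].
have Ssupp m : m \in msupp S -> m \in msupp T \/ m \in msupp T'.
  by move/msuppD_le; rewrite mem_cat => /orP[|]; [left | right].
have DS : hirota_zw D S = 0 by exact: hirota_zw_polarization.
have D2n : deg_le (2 * n) D by move=> m /Dsupp[/dT|/dT'].
have Dn : D@_(mk2 n n) = 0 by rewrite mcoeffB TT' subrr.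
have Dsym : swap_sym D by move=> a b; rewrite !mcoeffB sT sT'.
have De : even_deg D by move=> m /Dsupp[/eT|/eT'].
have Sn : S@_(mk2 n n) != 0.
  by rewrite mcoeffD -TT' -mulr2n -mulr_natl mulf_neq0 ?natr_neq0.
have S2n : deg_le (2 * n) S by move=> m /Ssupp[/dT|/dT'].
have Stop : {in msupp S, forall m, (m 0%R + m 1%R = 2 * n)%N -> m = mk2 n n}.
  by move=> m /Ssupp[/Ttop|/Ttop'].
have S31 : {in msupp S, forall m, 3 * m 0%R + m 1%R <= 4 * n}%N.
  by move=> m /Ssupp[/T31|/T31'].
(* The (3, 1)-weight of D is below 4 n, so S and 2 T have the same face. *)
have SE : S = T + T + D by rewrite /S /D; ring.
clearbody D S.
have [k [kn sodd dD Dk]] := deformation_top D2n Dn Dsym De D0 Sn S2n Stop DS.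
have D31 := deformation_weight31 D0 Sn S2n Stop S31 DS (ltnW kn) dD Dk.
have bT : (size (wexp 3 1 T) <= (4 * n).+1)%N.
  by apply: wexp_bound => m /T31; rewrite /weight mul1n.
have bD : (size (wexp 3 1 D) <= (3 * n + k).+1)%N.
  by apply: wexp_bound => m /D31; rewrite /weight mul1n.
have bS : (size (wexp 3 1 S) <= (4 * n).+1)%N.
  by apply: wexp_bound => m /S31; rewrite /weight mul1n.
have := face_kdv bD bS DS; have := face_kdv bT bT TT.
have -> : (wexp 3 1 S)`_(4 * n) = (wexp 3 1 T)`_(4 * n) + (wexp 3 1 T)`_(4 * n).
  rewrite SE !wexpD !coefD [(wexp 3 1 D)`_ _]nth_default ?addr0 //.
  by apply: leq_trans bD _; lia.
rewrite (hirota_faceDr (@derivD F) (@derivM F)).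
move=> h1; set h := hirota_face _ _ _ _ _ _ _ => h2.
have {h2} h2 : h = 0.
  apply/eqP; rewrite -[_ == 0]/(false || _) -(negbTE (natr_neq0 F (isT : 0 < 2)%N)).
  by rewrite -scaler_eq0 scaler_nat mulr2n h2.
rewrite /h {h} in h2.
have s4 : (4 * n = (3 * n + k) + (n - k))%N by lia.
have sth : size (wexp 3 1 T)`_(4 * n) = (k + (n - k)).+1.
  have -> : (4 * n = 3 * n + n)%N by lia.
  by rewrite size_face31 ?subnKC ?(ltnW kn) // addnn -mul2n.
have sphi := size_face31 dD Dk.
move: h1 h2 sth; rewrite s4 => h1 h2 sth.
have t0 : 4%:R / 3%:R != 0 :> F by rewrite mulf_neq0 ?invr_eq0 ?natr_neq0.
have := face_rigidity t0 sth sphi h1 h2; rewrite subn_gt0 => /(_ kn).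
by rewrite (negbTE sodd).
Qed.

Theorem zw_tau_proportional T T' : zw_tau T -> zw_tau T' -> exists2 c, c != 0 & T' = c *: T.
Proof.
move=> zT zT'; have [Tn _] := zw_tau_top zT; have [Tn' _] := zw_tau_top zT'.
pose c := T'@_(mk2 n n) / T@_(mk2 n n).
have c0 : c != 0 by rewrite mulf_neq0 ?invr_eq0.
exists c => //; apply: zw_tau_unique; [exact: zw_tauZ | by [] |].
by rewrite mcoeffZ divfK.
Qed.

End TauStructure.

(** * Substitution in two variables *)
Section Substitution.
Variables (R : comNzRingType).
Implicit Types (f g p : {mpoly R[2]}) (m : 'X_{1..2}).

Section OneSubstitution.
Variables (N : nat) (a b : {mpoly R[N]}).
Local Notation sub p := (bisubst p a b).

Lemma bisubstD f g : sub (f + g) = sub f + sub g.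
Proof. by rewrite /bisubst raddfD. Qed.

Lemma bisubstB f g : sub (f - g) = sub f - sub g.
Proof. by rewrite /bisubst raddfB. Qed.

Lemma bisubstN f : sub (- f) = - sub f.
Proof. by rewrite /bisubst raddfN. Qed.

Lemma bisubstM f g : sub (f * g) = sub f * sub g.
Proof. by rewrite /bisubst rmorphM. Qed.

Lemma bisubstZ c f : sub (c *: f) = c *: sub f.
Proof. by rewrite /bisubst linearZ. Qed.

Lemma bisubst0 : sub 0 = 0.
Proof. by rewrite /bisubst raddf0. Qed.

Lemma bisubst_nat k : sub k%:R = k%:R.
Proof. by rewrite /bisubst rmorph_nat. Qed.

Lemma bisubst_mono m : sub 'X_[m] = a ^+ m 0 * b ^+ m 1.
Proof. by rewrite /bisubst comp_mpolyX big_ord2. Qed.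

Lemma bisubstX0 : sub 'X_0 = a.
Proof. by rewrite bisubst_mono !mnm1E /= expr1 expr0 mulr1. Qed.

Lemma bisubstX1 : sub 'X_1 = b.
Proof. by rewrite bisubst_mono !mnm1E /= expr1 expr0 mul1r. Qed.

Lemma mderivXn (i : 'I_N) (u : {mpoly R[N]}) k :
  (u ^+ k.+1)^`M(i) = k.+1%:R *: (u ^+ k * u^`M(i)).
Proof.
elim: k => [|k IH]; first by rewrite expr1 expr0 mul1r scale1r.
rewrite exprS mderivM IH [k.+2%:R]mulrS scalerDl scale1r [X in X + _]mulrC; congr (_ + _).
by rewrite -scalerAr mulrA -exprS.
Qed.

Lemma mderiv_bisubst i f :
  (sub f)^`M(i) = sub f^`M(0) * a^`M(i) + sub f^`M(1) * b^`M(i).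
Proof.
elim/mpolyind: f => [|c m f _ _ IH]; first by rewrite !(mderiv0, bisubst0, mul0r, addr0).
rewrite !(mderivD, mderivZ, bisubstD, bisubstZ) IH !mulrDl addrACA; congr (_ + _).
rewrite !mderivX !bisubstZ -!scalerAl -scalerDr; congr (_ *: _).
rewrite !bisubst_mono !mnmBE !mnm1E /= !subn0 mderivM.
case: (m 0) (m 1) => [|k] [|l]; rewrite ?subn1 /= ?expr0 ?mderivXn ?scale0r
  -?mpolyC1 ?mderivC ?mpolyC1 ?(mul0r, mulr0, mul1r, mulr1, add0r, addr0) //.
all: by rewrite -!mul_mpolyC; ring.
Qed.

Lemma bisubst_comp_mpolyEX f :
  sub f = \sum_(m <- msupp f) f@_m *: (a ^+ m 0 * b ^+ m 1).
Proof.
by rewrite /bisubst comp_mpolyEX; apply: eq_bigr => m _; rewrite -bisubst_mono.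
Qed.

End OneSubstitution.

Lemma comp_bisubst N K (a b : {mpoly R[N]}) (lq : N.-tuple {mpoly R[K]}) f :
  (bisubst f a b) \mPo lq = bisubst f (a \mPo lq) (b \mPo lq).
Proof.
elim/mpolyind: f => [|c m f _ _ IH]; first by rewrite /bisubst !raddf0.
by rewrite !bisubstD !bisubstZ comp_mpolyD comp_mpolyZ IH !bisubst_mono rmorphM !rmorphXn.
Qed.

Lemma bisubst_comp N (a b : {mpoly R[2]}) (a' b' : {mpoly R[N]}) f :
  bisubst (bisubst f a b) a' b' = bisubst f (bisubst a a' b') (bisubst b a' b').
Proof. exact: comp_bisubst. Qed.

Lemma bisubst_id f : bisubst f 'X_0 'X_1 = f.
Proof.
elim/mpolyind: f => [|c m f _ _ IH]; first by rewrite bisubst0.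
by rewrite bisubstD bisubstZ IH bisubst_mono [in RHS]mpolyXE_id big_ord2.
Qed.

Lemma mcoeff_swap f a b : (bisubst f 'X_1 'X_0)@_(mk2 a b) = f@_(mk2 b a).
Proof.
elim/mpolyind: f => [|c m f _ _ IH]; first by rewrite bisubst0 !mcoeff0.
rewrite bisubstD bisubstZ !mcoeffD !mcoeffZ IH; congr (_ * _ + _).
have -> : bisubst 'X_[m] 'X_1 'X_0 = 'X_[mk2 (m 1) (m 0)] :> {mpoly R[2]}.
  by rewrite bisubst_mono [in RHS]mpolyXE_id big_ord2 mk2_0 mk2_1 mulrC.
rewrite !mcoeffX; congr (nat_of_bool _)%:R; apply/eqP/eqP => [e|->].
  by apply: mk2P; [rewrite -(mk2_1 (m 1) (m 0)) e | rewrite -(mk2_0 (m 1) (m 0)) e].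
by rewrite mk2_0 mk2_1.
Qed.

Lemma mcoeff_opp f m : (bisubst f (- 'X_0) (- 'X_1))@_m = (-1) ^+ (m 0%R + m 1%R)%N * f@_m.
Proof.
elim/mpolyind: f => [|c m' f _ _ IH]; first by rewrite bisubst0 !mcoeff0 mulr0.
rewrite bisubstD bisubstZ !mcoeffD !mcoeffZ IH mulrDr; congr (_ + _).
have -> : bisubst 'X_[m'] (- 'X_0) (- 'X_1) = ((-1) ^+ (m' 0%R + m' 1%R)%N : R) *: 'X_[m'] :> {mpoly R[2]}.
  rewrite bisubst_mono [in RHS]mpolyXE_id big_ord2 -!scaleN1r !exprZn -scalerAl -scalerAr scalerA.
  by rewrite -exprD.
rewrite mcoeffZ !mcoeffX; case: eqP => [->|_]; last by rewrite !mulr0.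
by rewrite !mulr1 mulrC.
Qed.

End Substitution.

(** * Expansion of the Hirota derivatives *)
Section BilinearExpansion.
Variables (V : zmodType) (A : comNzRingType).
Variables (pr : A -> A -> V) (E : V -> V) (phi : V -> A) (d : A -> A).
Hypotheses (ED : forall x y, E (x + y) = E x + E y) (EN : forall x, E (- x) = - E x).
Hypotheses (phiD : forall x y, phi (x + y) = phi x + phi y).
Hypotheses (phiN : forall x, phi (- x) = - phi x).
Hypotheses (Epr : forall f g, E (pr f g) = pr (d f) g - pr f (d g)).
Hypotheses (phipr : forall f g, phi (pr f g) = f * g).

(** Here pr f g stands for f(x) g(x'), E for the difference of the derivatives
    in x and x', and phi for the restriction to the diagonal. *)
Lemma iter2_expansion f : phi (iter 2 E (pr f f)) = 2%:R * (d (d f) * f - d f * d f).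
Proof. by rewrite /= !(Epr, ED, EN) !(phiD, phiN, phipr); ring. Qed.

Lemma iter4_expansion f : phi (iter 4 E (pr f f)) =
  2%:R * (iter 4 d f * f - 4%:R * (iter 3 d f * d f) + 3%:R * (iter 2 d f * iter 2 d f)).
Proof. by rewrite /= !(Epr, ED, EN) !(phiD, phiN, phipr); ring. Qed.

End BilinearExpansion.

Section HirotaExpansion.
Variables (R : comNzRingType).

Lemma mderiv_var N (i j : 'I_N) : ('X_j : {mpoly R[N]})^`M(i) = (j == i)%:R.
Proof.
rewrite mderivX mnm1E; case: eqP => [->|_]; last by rewrite scale0r.
rewrite scale1r -mpolyX0; congr 'X_[_]; apply/mnmP => k.
by rewrite mnmBE subnn mnm0E.
Qed.

Implicit Types (f g : {mpoly R[2]}).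

(** pr f g is f(x, y) g(x', y'), and [Dd 0 2] and [Dd 1 3] are the differences
    of derivatives in the two copies of x and of y. *)
Let pr f g : {mpoly R[4]} := bisubst f 'X_0 'X_1 * bisubst g 'X_2 'X_3.
Let Dd (i j : 'I_4) (P : {mpoly R[4]}) := P^`M(i) - P^`M(j).

Lemma DdD i j P Q : Dd i j (P + Q) = Dd i j P + Dd i j Q.
Proof. by rewrite /Dd !mderivD opprD addrACA. Qed.

Lemma DdN i j P : Dd i j (- P) = - Dd i j P.
Proof. by rewrite /Dd !mderivN opprB opprK addrC. Qed.

Lemma mderiv_sub_fst N (i j : 'I_N) f : j != i ->
  (bisubst f ('X_i : {mpoly R[N]}) 'X_j)^`M(i) = bisubst f^`M(0) 'X_i 'X_j.
Proof.
by move=> ji; rewrite mderiv_bisubst !mderiv_var eqxx (negbTE ji) mulr1 mulr0 addr0.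
Qed.

Lemma mderiv_sub_snd N (i j : 'I_N) f : j != i ->
  (bisubst f ('X_j : {mpoly R[N]}) 'X_i)^`M(i) = bisubst f^`M(1) 'X_j 'X_i.
Proof.
by move=> ji; rewrite mderiv_bisubst !mderiv_var eqxx (negbTE ji) mulr1 mulr0 add0r.
Qed.

Lemma mderiv_sub_none N (i j k : 'I_N) f : j != i -> k != i ->
  (bisubst f ('X_j : {mpoly R[N]}) 'X_k)^`M(i) = 0.
Proof.
move=> ji ki; rewrite mderiv_bisubst !mderiv_var (negbTE ji) (negbTE ki).
by rewrite !mulr0 addr0.
Qed.

Lemma Dd_pr_x f g : Dd 0 2 (pr f g) = pr f^`M(0) g - pr f g^`M(0).
Proof.
rewrite /Dd /pr !mderivM (mderiv_sub_fst _ (isT : (1 : 'I_4) != 0)).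
rewrite (mderiv_sub_none _ (isT : (2 : 'I_4) != 0) (isT : (3 : 'I_4) != 0)).
rewrite (mderiv_sub_none _ (isT : (0 : 'I_4) != 2) (isT : (1 : 'I_4) != 2)).
rewrite (mderiv_sub_fst _ (isT : (3 : 'I_4) != 2)).
by rewrite mulr0 mul0r addr0 add0r.
Qed.

Lemma Dd_pr_y f g : Dd 1 3 (pr f g) = pr f^`M(1) g - pr f g^`M(1).
Proof.
rewrite /Dd /pr !mderivM (mderiv_sub_snd _ (isT : (0 : 'I_4) != 1)).
rewrite (mderiv_sub_none _ (isT : (2 : 'I_4) != 1) (isT : (3 : 'I_4) != 1)).
rewrite (mderiv_sub_none _ (isT : (0 : 'I_4) != 3) (isT : (1 : 'I_4) != 3)).
rewrite (mderiv_sub_snd _ (isT : (2 : 'I_4) != 3)).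
by rewrite mulr0 mul0r addr0 add0r.
Qed.

Lemma pr_diagonal f g : pr f g \mPo [tuple 'X_0; 'X_1; 'X_0; 'X_1] = f * g.
Proof.
rewrite /pr rmorphM /= !comp_bisubst !comp_mpolyXU.
by rewrite /= !bisubst_id.
Qed.

Let diagonal (P : {mpoly R[4]}) : {mpoly R[2]} := P \mPo [tuple 'X_0; 'X_1; 'X_0; 'X_1].

Let diagonalD P Q : diagonal (P + Q) = diagonal P + diagonal Q.
Proof. exact: comp_mpolyD. Qed.

Let diagonalN P : diagonal (- P) = - diagonal P.
Proof. exact: comp_mpolyN. Qed.

Lemma hirota20 f : hirota 2 0 f f = 2%:R * (f^`M(0)^`M(0) * f - f^`M(0) * f^`M(0)).
Proof.
exact: (iter2_expansion (DdD 0 2) (DdN 0 2) diagonalD diagonalN Dd_pr_x pr_diagonal).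
Qed.

Lemma hirota02 f : hirota 0 2 f f = 2%:R * (f^`M(1)^`M(1) * f - f^`M(1) * f^`M(1)).
Proof.
exact: (iter2_expansion (DdD 1 3) (DdN 1 3) diagonalD diagonalN Dd_pr_y pr_diagonal).
Qed.

Lemma hirota40 f (d := mderiv 0) : hirota 4 0 f f =
  2%:R * (iter 4 d f * f - 4%:R * (iter 3 d f * d f) + 3%:R * (iter 2 d f * iter 2 d f)).
Proof.
exact: (iter4_expansion (DdD 0 2) (DdN 0 2) diagonalD diagonalN Dd_pr_x pr_diagonal).
Qed.

End HirotaExpansion.

(** * Complex coordinates *)
Local Opaque bisubst.

Section ComplexCoordinates.
Variable F : numClosedFieldType.
Implicit Types (f : {mpoly F[2]}).

Local Notation two := (2%:R : F).
Let x_zw : {mpoly F[2]} := two^-1 *: ('X_0 + 'X_1).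
Let y_zw : {mpoly F[2]} := (two * 'i)^-1 *: ('X_0 - 'X_1).
Let z_xy : {mpoly F[2]} := 'X_0 + 'i *: 'X_1.
Let w_xy : {mpoly F[2]} := 'X_0 - 'i *: 'X_1.

Definition to_zw f := bisubst f x_zw y_zw.
Definition to_xy f := bisubst f z_xy w_xy.

Let two0 : two != 0. Proof. exact: natr_neq0. Qed.
Let i0 : 'i != 0 :> F. Proof. exact: Num.Theory.neq0Ci. Qed.

Lemma to_zwK f : to_xy (to_zw f) = f.
Proof.
rewrite /to_xy /to_zw bisubst_comp.
have -> : bisubst x_zw z_xy w_xy = 'X_0.
  rewrite bisubstZ bisubstD bisubstX0 bisubstX1 addrACA subrr addr0.
  by rewrite -mulr2n -scaler_nat scalerA mulVf // scale1r.
have -> : bisubst y_zw z_xy w_xy = 'X_1.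
  rewrite bisubstZ bisubstB bisubstX0 bisubstX1 opprD opprK addrACA subrr add0r.
  by rewrite -mulr2n -scaler_nat !scalerA -mulrA mulVf ?mulf_neq0 // scale1r.
exact: bisubst_id.
Qed.

Lemma mderiv0_to_zw f :
  (to_zw f)^`M(0) = two^-1 *: to_zw f^`M(0) + (two * 'i)^-1 *: to_zw f^`M(1).
Proof.
rewrite /to_zw mderiv_bisubst /x_zw /y_zw !mderivZ !(mderivD, mderivN) !mderiv_var /=.
by rewrite mulr0n addr0 subr0 -!scalerAr !mulr1.
Qed.

Lemma mderiv1_to_zw f :
  (to_zw f)^`M(1) = two^-1 *: to_zw f^`M(0) - (two * 'i)^-1 *: to_zw f^`M(1).
Proof.
rewrite /to_zw mderiv_bisubst /x_zw /y_zw !mderivZ !(mderivD, mderivN) !mderiv_var /=.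
by rewrite mulr0n add0r sub0r -!scalerAr mulrN !mulr1 scalerN.
Qed.

(** The coordinates satisfy x = (z + w)/2 and y = (z - w)/(2 i), so that
    d/dz + d/dw is d/dx. *)
Lemma iter_dx_to_zw k f : iter k (@dx F) (to_zw f) = to_zw (iter k (mderiv 0) f).
Proof.
elim: k => //= k ->; rewrite /dx mderiv0_to_zw mderiv1_to_zw addrACA subrr addr0.
by rewrite -mulr2n -scaler_nat scalerA divff // scale1r.
Qed.

Let half_i2 : (two * 'i)^-1 * (two * 'i)^-1 = - (two * two)^-1 :> F.
Proof. by rewrite -invfM mulrACA -(expr2 'i) Num.Theory.sqrCi mulrN1 invrN. Qed.

Lemma mderiv01_to_zw f : (to_zw f)^`M(0)^`M(1)
  = (two * two)^-1 *: (to_zw f^`M(0)^`M(0) + to_zw f^`M(1)^`M(1)).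
Proof.
rewrite mderiv0_to_zw mderivD !mderivZ !mderiv1_to_zw [f^`M(1)^`M(0)]mderiv_comm.
rewrite !scalerBr !scalerA half_i2 scaleNr opprK addrA [(two * 'i)^-1 * _]mulrC.
by rewrite -[_ - _ + _]addrA addNr addr0 -invfM scalerDr.
Qed.

Lemma to_zw_nat k : to_zw k%:R = k%:R.
Proof. exact: bisubst_nat. Qed.

Lemma laplace_to_zw f : 4%:R * laplace_zw (to_zw f) (to_zw f)
  = to_zw (hirota 2 0 f f + hirota 0 2 f f).
Proof.
rewrite /laplace_zw mderiv01_to_zw mderiv0_to_zw mderiv1_to_zw hirota20 hirota02.
rewrite [RHS]bisubstD !bisubstM !bisubstB !bisubstM -!/(to_zw _) !to_zw_nat.
have h4 : 4%:R * (two * two)^-1%:MP = 1 :> {mpoly F[2]}.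
  have -> : 4%:R = (two * two)%:MP :> {mpoly F[2]} by rewrite -natrM -(rmorph_nat (@mpolyC 2 F)).
  by rewrite -mpolyCM divff ?mulf_neq0.
have hA : two^-1%:MP * two^-1%:MP = (two * two)^-1%:MP :> {mpoly F[2]}.
  by rewrite -mpolyCM -invfM.
have hB : (two * 'i)^-1%:MP * (two * 'i)^-1%:MP = - (two * two)^-1%:MP :> {mpoly F[2]}.
  by rewrite -mpolyCM half_i2 mpolyCN.
rewrite -!mul_mpolyC.
move: (two * two)^-1%:MP two^-1%:MP (two * 'i)^-1%:MP h4 hA hB => Q A B h4 hA hB.
move: (to_zw f) (to_zw f^`M(0)) (to_zw f^`M(1)) => t u v.
move: (to_zw _) (to_zw _) => a b.
transitivity ((4%:R * Q) * (2%:R * (a + b) * t) - 2%:R * ((4%:R * (A * A)) * (u * u))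
   + 2%:R * ((4%:R * (B * B)) * (v * v))); first by ring.
by rewrite hA hB mulrN h4; ring.
Qed.

Lemma hirota_to_zw f : hirota 2 0 f f + hirota 0 2 f f - hirota 4 0 f f = 0 ->
  hirota_zw (to_zw f) (to_zw f) = 0.
Proof.
move=> fE; rewrite /hirota_zw laplace_to_zw.
have -> : quartic_x (to_zw f) (to_zw f) = to_zw (hirota 4 0 f f).
  have E1 := iter_dx_to_zw 1 f; rewrite /= in E1.
  have E x y z : to_zw (2%:R * (x - 4%:R * y + 3%:R * z))
      = 2%:R * (to_zw x - 4%:R * to_zw y + 3%:R * to_zw z).
    rewrite {1}/to_zw bisubstM (bisubstD _ _ (x - _)) (bisubstB _ _ x).
    rewrite [bisubst (_ * y) _ _]bisubstM [bisubst (_ * z) _ _]bisubstM.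
    by rewrite -!/(to_zw _) !to_zw_nat.
  rewrite /quartic_x !iter_dx_to_zw E1 hirota40 E /to_zw !bisubstM.
  move: (bisubst f _ _) (bisubst (iter 4 _ _) _ _) (bisubst (iter 3 _ _) _ _) => a b c.
  move: (bisubst (iter 2 _ _) _ _) (bisubst _ _ _) => x y.
  ring.
by rewrite /to_zw -bisubstB fE bisubst0.
Qed.

Lemma mdeg2 (m : 'X_{1..2}) : mdeg m = (m 0%R + m 1%R)%N.
Proof. by rewrite mdegE big_ord2. Qed.

Lemma msize_exp_le2 (a : {mpoly F[2]}) k : (msize a <= 2)%N -> (msize (a ^+ k) <= k.+1)%N.
Proof.
move=> sa; elim: k => [|k IH]; first by rewrite expr0 msize1.
have [a0|a0] := eqVneq a 0; first by rewrite a0 expr0n msize0.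
rewrite exprS msizeM ?expf_neq0 //.
by rewrite -subn1 leq_subLR add1n -[k.+3]/(2 + k.+1)%N leq_add.
Qed.

Lemma msize_bisubst_le (a b f : {mpoly F[2]}) : (msize a <= 2)%N -> (msize b <= 2)%N ->
  (msize (bisubst f a b) <= msize f)%N.
Proof.
move=> sa sb; rewrite bisubst_comp_mpolyEX.
apply: leq_trans (mmeasure_sum _ _ _ _) _; rewrite big_seq; apply/bigmax_leqP_seq => m _ mf.
apply: leq_trans (mmeasureZ_le _ _ _) _.
apply: leq_trans _ (msize_mdeg_lt mf); rewrite mdeg2.
have := msize_exp_le2 (m 0) sa; have := msize_exp_le2 (m 1) sb.
have [->|a0] := eqVneq (a ^+ m 0) 0; first by rewrite mul0r msize0.
have [->|b0] := eqVneq (b ^+ m 1) 0; first by rewrite mulr0 msize0.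
rewrite msizeM // => sbl sak.
by rewrite -subn1 leq_subLR add1n -addnS -addSn leq_add.
Qed.

Let msize_lin (c d : F) : (msize (c *: 'X_0 + d *: 'X_1 : {mpoly F[2]})%R <= 2)%N.
Proof.
apply: leq_trans (mmeasureD_le _ _ _) _; rewrite geq_max.
by apply/andP; split; apply: leq_trans (mmeasureZ_le _ _ _) _; rewrite msizeX mdeg1.
Qed.

(** Linear substitutions do not raise the degree, and this one is
    invertible. *)
Lemma msize_to_zw f : msize (to_zw f) = msize f.
Proof.
have sx : (msize x_zw <= 2)%N by rewrite /x_zw scalerDr; exact: msize_lin.
have sy : (msize y_zw <= 2)%N by rewrite /y_zw scalerBr -scaleNr; exact: msize_lin.
have sz : (msize z_xy <= 2)%N by rewrite /z_xy -['X_0]scale1r; exact: msize_lin.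
have sw : (msize w_xy <= 2)%N by rewrite /w_xy -['X_0]scale1r -scaleNr; exact: msize_lin.
apply/eqP; rewrite eqn_leq msize_bisubst_le //=.
by rewrite -{1}(to_zwK f) msize_bisubst_le.
Qed.

Lemma to_zw_swap f : f = bisubst f 'X_0 (- 'X_1) ->
  bisubst (to_zw f) 'X_1 'X_0 = to_zw f.
Proof.
move=> fy; transitivity (to_zw (bisubst f 'X_0 (- 'X_1))); last by rewrite -fy.
rewrite /to_zw [LHS]bisubst_comp [RHS]bisubst_comp bisubstX0.
have -> : bisubst x_zw 'X_1 'X_0 = x_zw.
  by rewrite bisubstZ bisubstD bisubstX0 bisubstX1 addrC.
have -> : bisubst y_zw 'X_1 'X_0 = - y_zw.
  by rewrite bisubstZ bisubstB bisubstX0 bisubstX1 -scalerN opprB.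
by rewrite bisubstN bisubstX1.
Qed.

(** Both parities together make f invariant under (x, y) -> (-x, -y), which is
    (z, w) -> (-z, -w). *)
Lemma to_zw_opp f : f = bisubst f 'X_0 (- 'X_1) -> f = bisubst f (- 'X_0) 'X_1 ->
  bisubst (to_zw f) (- 'X_0) (- 'X_1) = to_zw f.
Proof.
move=> fy fx.
transitivity (to_zw (bisubst (bisubst f (- 'X_0) 'X_1) 'X_0 (- 'X_1))).
  rewrite /to_zw [LHS]bisubst_comp [in RHS]bisubst_comp [RHS]bisubst_comp.
  rewrite !(bisubstN, bisubstX0, bisubstX1).
  have -> : bisubst x_zw (- 'X_0) (- 'X_1) = - x_zw.
    by rewrite bisubstZ bisubstD bisubstX0 bisubstX1 -scalerN opprD.
  have -> // : bisubst y_zw (- 'X_0) (- 'X_1) = - y_zw.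
  by rewrite bisubstZ bisubstB bisubstX0 bisubstX1 -scalerN opprD.
by rewrite -fx -fy.
Qed.

Lemma zw_tau_to_zw n f : is_even_lump_tau n f -> zw_tau n (to_zw f).
Proof.
case=> deg fy fx fE; rewrite /has_total_degree in deg.
have sT : msize (to_zw f) = (2 * n).+1 by rewrite msize_to_zw.
split.
- by move=> m /msize_mdeg_lt; rewrite sT mdeg2.
- have T0 : to_zw f != 0 by rewrite -msize_poly_eq0 sT.
  exists (mlead (to_zw f)); first exact: mlead_supp.
  by have := mlead_deg T0; rewrite sT mdeg2 => -[].
- by move=> a b; rewrite -[in LHS](to_zw_swap fy) mcoeff_swap.
- move=> m; rewrite mcoeff_msupp; apply: contraNN => om; rewrite -[_ == _]orFb.
  rewrite -(negbTE (natr_neq0 F (isT : 0 < 2)%N)) -mulf_eq0 mulr_natl mulr2n addr_eq0.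
  by rewrite -{1}(to_zw_opp fy fx) mcoeff_opp -signr_odd om mulN1r.
exact: hirota_to_zw.
Qed.

Lemma is_even_lump_tau_proportional n f g :
  is_even_lump_tau n f -> is_even_lump_tau n g -> exists2 c, c != 0 & g = c *: f.
Proof.
move=> /zw_tau_to_zw hf /zw_tau_to_zw hg.
have [c c0 E] := zw_tau_proportional hf hg; exists c => //.
by rewrite -(to_zwK g) E /to_xy bisubstZ -/(to_xy _) to_zwK.
Qed.

End ComplexCoordinates.

(** * Extension of scalars and descent to the reals *)
Section ScalarExtension.
Variables (R S : comNzRingType) (h : {rmorphism R -> S}).
Hypothesis h_inj : injective h.
Local Notation "f ^h" := (map_mpoly h f) (at level 2, format "f ^h").
Implicit Types (f g : {mpoly R[2]}).

Lemma map_bisubst N f (a b : {mpoly R[N]}) : (bisubst f a b)^h = bisubst f^h a^h b^h.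
Proof.
elim/mpolyind: f => [|c m f _ _ IH]; first by rewrite bisubst0 !raddf0 bisubst0.
rewrite bisubstD bisubstZ !raddfD /= !map_mpolyZ IH bisubstD bisubstZ map_mpolyX.
by rewrite !bisubst_mono rmorphM !rmorphXn.
Qed.

Lemma map_mderiv N i (p : {mpoly R[N]}) : p^`M(i)^h = p^h^`M(i).
Proof.
by apply/mpolyP => m; rewrite !(mcoeff_map_mpoly, mcoeff_deriv) raddfMn.
Qed.

Lemma map_hirota20 f : (hirota 2 0 f f)^h = hirota 2 0 f^h f^h.
Proof. by rewrite !hirota20 rmorphM rmorphB !rmorphM rmorph_nat /= !map_mderiv. Qed.

Lemma map_hirota02 f : (hirota 0 2 f f)^h = hirota 0 2 f^h f^h.
Proof. by rewrite !hirota02 rmorphM rmorphB !rmorphM rmorph_nat /= !map_mderiv. Qed.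

Lemma map_hirota40 f : (hirota 4 0 f f)^h = hirota 4 0 f^h f^h.
Proof.
have E (x y z : {mpoly R[2]}) : (2%:R * (x - 4%:R * y + 3%:R * z))^h
    = 2%:R * (x^h - 4%:R * y^h + 3%:R * z^h).
  rewrite rmorphM [_ (_ + 3%:R * z)]rmorphD [_ (x - _)]rmorphB.
  by rewrite [_ (_ * y)]rmorphM [_ (_ * z)]rmorphM !rmorph_nat.
by rewrite !hirota40 E !rmorphM /= !map_mderiv.
Qed.

Lemma is_even_lump_tau_map n f : is_even_lump_tau n f -> is_even_lump_tau n f^h.
Proof.
case=> deg fy fx fE; split.
- by rewrite /has_total_degree -deg !msizeE (perm_big _ (msupp_map_mpoly f h_inj)).
- by rewrite {1}fy map_bisubst raddfN /= !map_mpolyX.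
- by rewrite {1}fx map_bisubst raddfN /= !map_mpolyX.
have := congr1 (map_mpoly h) fE; rewrite raddf0 => <-.
by rewrite raddfB raddfD /= map_hirota20 map_hirota02 map_hirota40.
Qed.

End ScalarExtension.

Theorem theorem2 (R : realType) (k n : nat) (hk : (0 < k)%N)
    (hn : n = ((k * (k + 1)) %/ 2)%N) (hn300 : (n <= 300)%N)
    (tau1 tau2 : {mpoly R[2]}) 
    (htau1 : is_even_lump_tau n tau1) (htau2 : is_even_lump_tau n tau2) :
  exists2 c : R, c != 0 & tau2 = c *: tau1.
Proof.
have h_inj := @complexI R.
have [c c0 E] := is_even_lump_tau_proportional (F := R[i])
  (is_even_lump_tau_map h_inj htau1) (is_even_lump_tau_map h_inj htau2).
have Em m : (tau2@_m)%:C%C = c * (tau1@_m)%:C%C.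
  by rewrite -!(mcoeff_map_mpoly (real_complex R)) E mcoeffZ.
have [m m0] : exists m, tau1@_m != 0.
  have t0 : tau1 != 0 by rewrite -msize_poly_eq0; case: htau1 => ->.
  by exists (mlead tau1); rewrite mleadc_eq0.
(* The complex factor is determined by one nonzero real coefficient of tau1. *)
pose r := tau2@_m / tau1@_m.
have rc : r%:C%C = c.
  by rewrite /r rmorphM fmorphV /= Em mulfK // fmorph_eq0.
exists r; first by rewrite -(fmorph_eq0 (real_complex R)) /= rc.
by apply/mpolyP => m'; apply: h_inj; rewrite mcoeffZ rmorphM /= rc Em.
Qed.
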